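(* Let $\Lambda=\mathcal{H}^n$ for $n=1$ or $2$, and $L=\Lambda\oplus II_{1,1}^{\mathcal{H}}$. Then $\mathrm{Reflec}_0\,L$ acts transitively on the primitive null vectors of $L$ and has index at most $4$ in $\mathrm{Aut}\,L$; coset representatives may be taken from $\{T_{0,0},T_{0,i},T_{0,j},T_{0,k}\}$.
   Context: $\mathcal{H}$ is the ring of Hurwitz integers, the integral span of its $24$ units $\pm1,\pm i,\pm j,\pm k,(\pm1\pm i\pm j\pm k)/2$ in the quaternions $\mathbb{H}$. An $\mathcal{H}$-lattice is a free right $\mathcal{H}$-module of finite rank with a biadditive $\mathcal{H}$-valued pairing satisfying $\langle x|y\rangle=\overline{\langle y|x\rangle}$ and $\langle x|y\alpha\rangle=\langle x|y\rangle\alpha$. $\mathcal{H}^n$ carries the form $\sum\bar x_iy_i$; $II_{1,1}^{\mathcal{H}}$ is $\mathcal{H}^2$ with inner product matrix $\begin{pmatrix}0&1\\1&0\end{pmatrix}$. Elements of $L$ are written $(\lambda;\mu,\nu)$ with $\lambda\in\Lambda$, $\mu,\nu\in\mathcal{H}$. The norm of $v$ is $v^2=\langle v|v\rangle$; $v$ is null if $v^2=0$. A nonzero $v\in L$ is primitive if $v=w\alpha$ with $w\in L$, $\alpha\in\mathcal{H}$ implies $\alpha$ is a unit. For $r$ of norm $1$ and a unit $\xi\ne 1$ of $\mathcal{H}$, the $\xi$-reflection in $r$ is $v\mapsto v-r(1-\xi)\langle r|v\rangle$. $\mathrm{Reflec}_0\,L$ is the subgroup of $\mathrm{Aut}\,L$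 generated by all such reflections in the short roots (norm $1$ vectors) of $L$. For $x\in\Lambda\otimes\mathbb{R}$ and $z$ a purely imaginary quaternion, the translation $T_{x,z}$ is the isometry $(\lambda;\mu,\nu)\mapsto(\lambda+x\mu;\ \mu,\ \nu-\langle x|\lambda\rangle+(z-x^2/2)\mu)$ of $L\otimes\mathbb{R}$. *)

(* Defs.v *)
From HB Require Import structures.
From mathcomp Require Import all_boot all_order all_algebra.
From mathcomp Require Import boolp classical_sets cardinality reals.
From mathcomp Require Import ring lra.

Set Implicit Arguments.
Unset Strict Implicit.
Unset Printing Implicit Defensive.

Import Order.TTheory GRing.Theory Num.Theory.
Local Open Scope ring_scope.
Local Open Scope classical_set_scope.

Record quat (R : Type) : Type := Quat { qre : R; qci : R; qcj : R; qck : R }.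

Section Quaternions.
Variable R : realType.
Local Notation H := (quat R).
Implicit Types p q s : H.

Definition quat_tuple q := (qre q, qci q, qcj q, qck q).
Definition tuple_quat (t : R * R * R * R) : H :=
  let: (a, b, c, d) := t in Quat a b c d.

Lemma quat_tupleK : cancel quat_tuple tuple_quat.
Proof. by case. Qed.

HB.instance Definition _ := Choice.copy H (can_type quat_tupleK).

Lemma quatP p q : qre p = qre q -> qci p = qci q -> qcj p = qcj q ->
  qck p = qck q -> p = q.
Proof. by case: p q => ? ? ? ? [? ? ? ?] /= -> -> -> ->. Qed.

Definition qzero : H := Quat 0 0 0 0.
Definition qopp q : H := Quat (- qre q) (- qci q) (- qcj q) (- qck q).
Definition qadd p q : H :=
  Quat (qre p + qre q) (qci p + qci q) (qcj p + qcj q) (qck p + qck q).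

Lemma qaddA : associative qadd.
Proof. by move=> p q s; apply: quatP; rewrite /= addrA. Qed.
Lemma qaddC : commutative qadd.
Proof. by move=> p q; apply: quatP; rewrite /= addrC. Qed.
Lemma qadd0 : left_id qzero qadd.
Proof. by move=> p; apply: quatP; rewrite /= add0r. Qed.
Lemma qaddN : left_inverse qzero qopp qadd.
Proof. by move=> p; apply: quatP; rewrite /= addNr. Qed.

HB.instance Definition _ := GRing.isZmodule.Build H qaddA qaddC qadd0 qaddN.

Definition qone : H := Quat 1 0 0 0.
Definition qmul p q : H :=
  Quat (qre p * qre q - qci p * qci q - qcj p * qcj q - qck p * qck q)
       (qre p * qci q + qci p * qre q + qcj p * qck q - qck p * qcj q)
       (qre p * qcj q - qci p * qck q + qcj p * qre q + qck p * qci q)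
       (qre p * qck q + qci p * qcj q - qcj p * qci q + qck p * qre q).

Lemma qmulA : associative qmul.
Proof. by move=> p q s; apply: quatP => /=; ring. Qed.
Lemma qmul1l : left_id qone qmul.
Proof. by move=> p; apply: quatP => /=; ring. Qed.
Lemma qmul1r : right_id qone qmul.
Proof. by move=> p; apply: quatP => /=; ring. Qed.
Lemma qmulDl : left_distributive qmul +%R.
Proof. by move=> p q s; apply: quatP => /=; ring. Qed.
Lemma qmulDr : right_distributive qmul +%R.
Proof. by move=> p q s; apply: quatP => /=; ring. Qed.
Lemma qone_neq0 : qone != 0.
Proof. by apply/eqP => -[] /eqP; rewrite oner_eq0. Qed.

HB.instance Definition _ :=
  GRing.Zmodule_isNzRing.Build H qmulA qmul1l qmul1r qmulDl qmulDr qone_neq0.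

Definition qscale (a : R) q : H :=
  Quat (a * qre q) (a * qci q) (a * qcj q) (a * qck q).

Lemma qscaleA a b q : qscale a (qscale b q) = qscale (a * b) q.
Proof. by apply: quatP; rewrite /= mulrA. Qed.
Lemma qscale1 : left_id 1 qscale.
Proof. by move=> q; apply: quatP; rewrite /= mul1r. Qed.
Lemma qscaleDr : right_distributive qscale +%R.
Proof. by move=> a p q; apply: quatP; rewrite /= mulrDr. Qed.
Lemma qscaleDl q : {morph qscale^~ q : a b / a + b}.
Proof. by move=> a b; apply: quatP; rewrite /= mulrDl. Qed.

HB.instance Definition _ :=
  GRing.Zmodule_isLmodule.Build R H qscaleA qscale1 qscaleDr qscaleDl.

Definition qi : H := Quat 0 1 0 0.
Definition qj : H := Quat 0 0 1 0.
Definition qk : H := Quat 0 0 0 1.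

Definition qconj q : H := Quat (qre q) (- qci q) (- qcj q) (- qck q).
Definition qnorm q : R := qre q ^+ 2 + qci q ^+ 2 + qcj q ^+ 2 + qck q ^+ 2.

Lemma qnormM p q : qnorm (p * q) = qnorm p * qnorm q.
Proof. rewrite /qnorm /=; ring. Qed.
Lemma qnorm1 : qnorm 1 = 1.
Proof. rewrite /qnorm /=; ring. Qed.
Lemma qnorm_ge0 q : 0 <= qnorm q.
Proof. by rewrite !addr_ge0 ?sqr_ge0. Qed.
Lemma qmul_conj q : q * qconj q = qnorm q *: (1 : H).
Proof. by apply: quatP; rewrite /= /qnorm; ring. Qed.
Lemma qconj_mul q : qconj q * q = qnorm q *: (1 : H).
Proof. by apply: quatP; rewrite /= /qnorm; ring. Qed.

End Quaternions.

Arguments qi {R}.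
Arguments qj {R}.
Arguments qk {R}.

Section Hurwitz.
Variable R : realType.
Local Notation H := (quat R).
Implicit Types p q : H.

Definition hurwitz_units : seq H :=
  let pm : seq R := [:: 1; -1] in
  [seq a *: q | a <- pm, q <- [:: 1; qi; qj; qk]] ++
  [seq (2^-1 : R) *: (p + q)
     | p <- [seq a *: (1 : H) + b *: qi | a <- pm, b <- pm],
       q <- [seq c *: qj + d *: qk | c <- pm, d <- pm]].

Lemma size_hurwitz_units : size hurwitz_units = 24%N.
Proof. by []. Qed.

Definition hurwitzp : pred H :=
  fun q => `[< inIntSpan (in_tuple hurwitz_units) q >].

Definition hcoord (a b c d : int) : H :=
  Quat (a%:~R / 2) (a%:~R / 2 + b%:~R) (a%:~R / 2 + c%:~R) (a%:~R / 2 + d%:~R).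

Lemma inIntSpanD m (s : m.-tuple H) p q :
  inIntSpan s p -> inIntSpan s q -> inIntSpan s (p + q).
Proof.
move=> [a ->] [b ->]; exists [ffun i => a i + b i].
by rewrite -big_split; apply: eq_bigr => i _; rewrite ffunE mulrzDr.
Qed.

Lemma inIntSpanMz m (s : m.-tuple H) p z : inIntSpan s p -> inIntSpan s (p *~ z).
Proof.
move=> [a ->]; exists [ffun i => a i * z].
by rewrite mulrz_suml; apply: eq_bigr => i _; rewrite ffunE mulrzA.
Qed.

Lemma inIntSpan_mem m (s : m.-tuple H) p : p \in tval s -> inIntSpan s p.
Proof.
case/tnthP => i ->; exists [ffun j => (j == i)%:R].
rewrite (bigD1 i)//= ffunE eqxx mulr1z big1 => [|j /negPf ji].
  by rewrite addr0 (tnth_nth 0).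
by rewrite ffunE ji mulr0z.
Qed.

Lemma qmulrz q (z : int) : q *~ z = (z%:~R : R) *: q.
Proof. by rewrite scaler_int. Qed.

Lemma hcoordE a b c d :
  hcoord a b c d = (2^-1 *: (1 + qi + qj + qk) : H) *~ a + qi *~ b + qj *~ c + qk *~ d.
Proof. by rewrite !qmulrz; apply: quatP => /=; field. Qed.

Lemma hurwitzP q :
  reflect (exists a b c d, q = hcoord a b c d) (hurwitzp q).
Proof.
apply: (iffP (asboolP _)).
  case=> f ->.
  apply: (big_ind (fun q => exists a b c d, q = hcoord a b c d)).
  - by exists 0, 0, 0, 0; apply: quatP => /=; field.
  - move=> _ _ [a [b [c [d ->]]]] [a' [b' [c' [d' ->]]]].
    by exists (a + a'), (b + b'), (c + c'), (d + d'); apply: quatP => /=; field.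
  - move=> i _.
    suff [a [b [c [d ->]]]] : exists a b c d, (in_tuple hurwitz_units)`_i = hcoord a b c d.
      exists (a * f i), (b * f i), (c * f i), (d * f i).
      by rewrite qmulrz; apply: quatP; rewrite /= !rmorphM/=; field.
    have : all (fun q : H => `[< exists a b c d, q = hcoord a b c d >]) hurwitz_units.
      have Q (x y z t : int) p : p = hcoord x y z t ->
          `[< exists a b c d, p = hcoord a b c d >].
        by move=> ->; apply/asboolP; exists x, y, z, t.
      rewrite /hurwitz_units /=.
      repeat match goal with |- is_true (_ && _) => apply/andP; split end => //.
      + by apply: (Q 2 (-1) (-1) (-1)); apply: quatP => /=; field.
      + by apply: (Q 0 1 0 0); apply: quatP => /=; field.
      + by apply: (Q 0 0 1 0); apply: quatP => /=; field.
      + by apply: (Q 0 0 0 1); apply: quatP => /=; field.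
      + by apply: (Q (-2) 1 1 1); apply: quatP => /=; field.
      + by apply: (Q 0 (-1) 0 0); apply: quatP => /=; field.
      + by apply: (Q 0 0 (-1) 0); apply: quatP => /=; field.
      + by apply: (Q 0 0 0 (-1)); apply: quatP => /=; field.
      + by apply: (Q 1 0 0 0); apply: quatP => /=; field.
      + by apply: (Q 1 0 0 (-1)); apply: quatP => /=; field.
      + by apply: (Q 1 0 (-1) 0); apply: quatP => /=; field.
      + by apply: (Q 1 0 (-1) (-1)); apply: quatP => /=; field.
      + by apply: (Q 1 (-1) 0 0); apply: quatP => /=; field.
      + by apply: (Q 1 (-1) 0 (-1)); apply: quatP => /=; field.
      + by apply: (Q 1 (-1) (-1) 0); apply: quatP => /=; field.
      + by apply: (Q 1 (-1) (-1) (-1)); apply: quatP => /=; field.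
      + by apply: (Q (-1) 1 1 1); apply: quatP => /=; field.
      + by apply: (Q (-1) 1 1 0); apply: quatP => /=; field.
      + by apply: (Q (-1) 1 0 1); apply: quatP => /=; field.
      + by apply: (Q (-1) 1 0 0); apply: quatP => /=; field.
      + by apply: (Q (-1) 0 1 1); apply: quatP => /=; field.
      + by apply: (Q (-1) 0 1 0); apply: quatP => /=; field.
      + by apply: (Q (-1) 0 0 1); apply: quatP => /=; field.
      + by apply: (Q (-1) 0 0 0); apply: quatP => /=; field.
    by move=> /allP/(_ _ (mem_nth 0 (ltn_ord i)))/asboolP.
have U (i : 'I_24) q' : q' = hurwitz_units`_i ->
    inIntSpan (in_tuple hurwitz_units) q'.
  by move=> ->; apply: inIntSpan_mem; apply: mem_nth.
move=> [a [b [c [d ->]]]]; rewrite hcoordE.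
do ! apply: inIntSpanD; apply: inIntSpanMz.
- by apply: (U (@Ordinal 24 8 isT)); rewrite /= !scale1r ?addrA.
- by apply: (U (@Ordinal 24 1 isT)); rewrite /= !scale1r ?addrA.
- by apply: (U (@Ordinal 24 2 isT)); rewrite /= !scale1r ?addrA.
- by apply: (U (@Ordinal 24 3 isT)); rewrite /= !scale1r ?addrA.
Qed.

Lemma hurwitz_subring : subring_closed hurwitzp.
Proof.
split; rewrite /in_mem /=.
- by apply/hurwitzP; exists 2, (-1), (-1), (-1); apply: quatP => /=; field.
- move=> _ _ /hurwitzP[a [b [c [d ->]]]] /hurwitzP[a' [b' [c' [d' ->]]]].
  apply/hurwitzP; exists (a - a'), (b - b'), (c - c'), (d - d').
  by apply: quatP => /=; field.
- move=> _ _ /hurwitzP[a [b [c [d ->]]]] /hurwitzP[a' [b' [c' [d' ->]]]].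
  pose r := - a * a' - a * b' - a * c' - a * d' - b * a' - c * a' - d * a'
            - 2 * b * b' - 2 * c * c' - 2 * d * d'.
  apply/hurwitzP.
  exists r.
  exists (a * a' + a * b' + a * d' + b * a' + c * a' + b * b' + c * c' + d * d'
          + c * d' - d * c').
  exists (a * a' + a * b' + a * c' + c * a' + d * a' + b * b' + c * c' + d * d'
          + d * b' - b * d').
  exists (a * a' + a * c' + a * d' + b * a' + d * a' + b * b' + c * c' + d * d'
          + b * c' - c * b').
  by rewrite /r; apply: quatP; rewrite /= ?(rmorphB, rmorphD, rmorphM, rmorphN) /=; field.
Qed.

HB.instance Definition _ := GRing.isSubringClosed.Build H hurwitzp hurwitz_subring.

Record hurwitz : Type := Hurwitz { hval :> H; _ : hurwitzp hval }.

HB.instance Definition _ := [isSub for hval].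
HB.instance Definition _ := [Choice of hurwitz by <:].
HB.instance Definition _ := [SubChoice_isSubNzRing of hurwitz by <:].

Lemma hurwitzp_conj q : hurwitzp q -> hurwitzp (qconj q).
Proof.
move=> /hurwitzP[a [b [c [d ->]]]]; apply/hurwitzP.
by exists a, (- a - b), (- a - c), (- a - d); apply: quatP => /=; field.
Qed.

Definition hconj (x : hurwitz) : hurwitz := Hurwitz (hurwitzp_conj (valP x)).

Lemma hurwitz_norm_int (x : hurwitz) : exists m : int, qnorm (hval x) = m%:~R.
Proof.
case: x => _ /= /hurwitzP[a [b [c [d ->]]]].
exists (a ^+ 2 + a * (b + c + d) + b ^+ 2 + c ^+ 2 + d ^+ 2).
by rewrite /qnorm /= !(rmorphD, rmorphM, rmorphXn)/=; field.
Qed.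

Definition hunit : pred hurwitz := fun x => qnorm (hval x) == 1.
Definition hinv (x : hurwitz) : hurwitz := if hunit x then hconj x else x.

Lemma hmulVr : {in hunit, left_inverse 1 hinv *%R}.
Proof.
move=> x; rewrite unfold_in => Hx; rewrite /hinv /hunit Hx; apply: val_inj => /=.
by rewrite qconj_mul (eqP Hx) scale1r.
Qed.
Lemma hdivrr : {in hunit, right_inverse 1 hinv *%R}.
Proof.
move=> x; rewrite unfold_in => Hx; rewrite /hinv /hunit Hx; apply: val_inj => /=.
by rewrite qmul_conj (eqP Hx) scale1r.
Qed.
Lemma hunitrP (x y : hurwitz) : y * x = 1 /\ x * y = 1 -> hunit x.
Proof.
case=> _ /(congr1 (fun t => qnorm (hval t))) /=.
rewrite qnormM qnorm1 /hunit.
have := qnorm_ge0 (hval x); have := qnorm_ge0 (hval y).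
have [m ->] := hurwitz_norm_int x; have [m' ->] := hurwitz_norm_int y.
rewrite !ler0z -intrM -[1]/(1%:~R) !eqr_int => m'0 m0 /eqP; rewrite eqr_int => /eqP.
by move: m m' m0 m'0 => [] m [] m' //= _ _ [/eqP]; rewrite muln_eq1 => /andP[/eqP->].
Qed.
Lemma hinv_out : {in [predC hunit], hinv =1 id}.
Proof. by move=> x; rewrite inE /= unfold_in /hinv /hunit => /negPf ->. Qed.

HB.instance Definition _ :=
  GRing.NzRing_hasMulInverse.Build hurwitz hmulVr hdivrr hunitrP hinv_out.

End Hurwitz.

(* For K the Hurwitz ring this is L = Lambda + II_{1,1}, and for K the
   quaternions it is L (x) RR; the vector (lambda; mu, nu) is encoded as
   (lambda, (mu, nu)). *)
Notation hlat K n := ('cV[K]_n * (K * K))%type.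

Section HermitianModule.
Variables (K : nzRingType) (conj : K -> K) (n : nat).

Definition scol (x : 'cV[K]_n) (a : K) : 'cV[K]_n := \col_i (x i 0 * a).

Definition sright (v : hlat K n) (a : K) : hlat K n :=
  let: (lam, (mu, nu)) := v in (scol lam a, (mu * a, nu * a)).

Definition dot (x y : 'cV[K]_n) : K := \sum_i conj (x i 0) * y i 0.

Definition hyp (x y : K * K) : K := conj x.1 * y.2 + conj x.2 * y.1.

Definition hform (v w : hlat K n) : K := dot v.1 w.1 + hyp v.2 w.2.

End HermitianModule.

Section Lattice.
Variables (R : realType) (n : nat).
Local Notation H := (quat R).
Local Notation Hz := (hurwitz R).
Local Notation L := (hlat Hz n).
Local Notation LR := (hlat H n).

Definition lform (v w : L) : Hz := hform (@hconj R) v w.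

Definition null (v : L) : Prop := lform v v = 0.

Definition primitive (v : L) : Prop :=
  v <> 0 /\
  forall (w : L) (a : Hz), v = sright w a -> a \is a GRing.unit.

Definition AutL : set (L -> L) := [set g : L -> L |
  [/\ bijective g,
      {morph g : v w / v + w},
      forall v a, g (sright v a) = sright (g v) a &
      forall v w, lform (g v) (g w) = lform v w]].

Definition reflection (xi : Hz) (r v : L) : L :=
  v - sright r ((1 - xi) * lform r v).

Definition short_reflections : set (L -> L) :=
  [set g : L -> L | exists (xi : Hz) (r : L),
    [/\ xi \is a GRing.unit, xi != 1, lform r r = 1 & g = reflection xi r]].

Definition subgroup_AutL (G : set (L -> L)) : Prop :=
  [/\ G `<=` AutL, G id,
      forall f g, G f -> G g -> G (f \o g) &
      forall f g, G f -> cancel f g -> cancel g f -> G g].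

Definition Reflec0 : set (L -> L) := smallest subgroup_AutL short_reflections.

Definition translation (x : 'cV[H]_n) (z : H) (v : LR) : LR :=
  let: (lam, (mu, nu)) := v in
  (lam + scol x mu,
   (mu, nu - dot (@qconj R) x lam + (z - 2^-1 *: dot (@qconj R) x x) * mu)).

Definition toLR (v : L) : LR :=
  (map_mx (@hval R) v.1, (hval v.2.1, hval v.2.2)).

Definition restricts_to (g : L -> L) (f : LR -> LR) : Prop :=
  forall v, toLR (g v) = f (toLR v).

Definition central_translations : set (L -> L) :=
  [set g : L -> L | exists2 z : H, z \in [:: 0; qi; qj; qk] &
           restricts_to g (translation 0 z)].

End Lattice.

Definition acts_transitively (T : Type) (G : set (T -> T)) (X : set T) : Prop :=
  (forall g x, G g -> X x -> X (g x)) /\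
  (forall x y, X x -> X y -> exists2 g, G g & g x = y).

(* Reflec0 is normal in AutL (conjugating a short reflection by an
   automorphism gives a short reflection), so left and right cosets agree. *)
Definition left_coset (T : Type) (g : T -> T) (S : set (T -> T)) :
  set (T -> T) := [set g \o s | s in S].

Definition left_cosets (T : Type) (G S : set (T -> T)) : set (set (T -> T)) :=
  [set left_coset g S | g in G].

Definition coset_reps (T : Type) (G S C : set (T -> T)) : Prop :=
  C `<=` G /\ forall g, G g -> exists! c, C c /\ left_coset c S g.

(* Main.v *)
Require Import Defs.
From mathcomp Require Import all_boot all_order all_algebra.
From mathcomp Require Import boolp classical_sets cardinality reals.
From mathcomp Require Import ring lra.

(** Write [rho = (0;0,1)], [sigma = (0;1,0)], and call the height of
    [v = (lambda;mu,nu)] the coordinate [mu = <rho|v>].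

    Transitivity is a Euclidean algorithm on the norm of the height.  Let [v] be
    null of height [mu <> 0], let [x] be a lattice point of [Lambda] at squared
    distance [d] from [lambda/mu], and let [r = (x;1,k)] be a short root.  Since
    [r] has norm 1 and [v] is null, [t = <r|v>/mu] has real part [(1 - d)/2];
    the imaginary part of [k] is free modulo integers, so that of [t] may be
    taken with coordinates in [-1/2, 1/2].  The [xi]-reflection in [r]
    multiplies the height by [1 - (1 - xi) t] on the left, and for a suitable
    unit [1 - xi = (1 +- i +- j +- k)/2] this has norm less than 1 as soon as
    [d <= 1], except when [t = 0] and [d = 1] ([half_unit_contract]).  Every
    quaternion is within squared distance 1/2 of a Hurwitz integer
    ([hurwitz_covering]), so [d <= n/2 <= 1].  The exception forces [n = 2] and
    [lambda/mu] to be a deep hole in each coordinate; the hole has several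
    nearest lattice points, and [t] cannot vanish for two neighbouring choices
    ([height_reduction]).  At height 0 a primitive null vector is [rho u] with
    [u] a unit, and products of two reflections of the hyperbolic plane carry
    [rho] to every [rho u] ([reached_unit]).

    For the index, [Reflec0] is normal, so the products [T_{0,z} s] with [z]
    imaginary and [s] in [Reflec0] form a group [G]; the claim is that it is all
    of [AutL].  Given an automorphism, multiply by reflections to make it fix
    [rho], then by reflections in roots orthogonal to [rho] to send [sigma] to
    some [(0;1,k)] ([Reflec0_clear]), then by a central translation to make it
    fix [sigma].  It is now an automorphism of [Lambda = H^n], that is, a
    permutation of the coordinates combined with units acting on each; the
    latter are reflections in short roots.  A transposition is the reflection in
    a norm 2 vector [e_i - e_j], which [G] carries to [(0;1,1)], and the
    reflection in [(0;1,1)] is an explicit element of [G]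
    ([ctrans_Reflec0_swap_hyp], [ctrans_Reflec0_swap]).

    Finally [T_{0,z}] is a product of three reflections when
    [z = +- i +- j +- k] ([Reflec0_ctrans_half]).  These [z] generate a subgroup
    of the imaginary Hurwitz integers with quotient represented by
    [0, i, j, k]. *)

Set Implicit Arguments.
Unset Strict Implicit.
Unset Printing Implicit Defensive.

Import Order.TTheory GRing.Theory Num.Theory.
Local Open Scope ring_scope.
Local Open Scope classical_set_scope.
Local Open Scope card_scope.

Ltac hurwitz_ring := apply: val_inj; apply: quatP => /=; ring.
Ltac hurwitz_field := by apply: val_inj; apply: quatP => /=; field.

(** * Arithmetic of the Hurwitz integers *)

Section HurwitzArithmetic.
Variable R : realType.
Local Notation H := (quat R).
Local Notation Hz := (hurwitz R).
Implicit Types x y z : Hz.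

Lemma hconjD x y : hconj (x + y) = hconj x + hconj y.
Proof. hurwitz_ring. Qed.

Lemma hconjN x : hconj (- x) = - hconj x.
Proof. hurwitz_ring. Qed.

Lemma hconjB x y : hconj (x - y) = hconj x - hconj y.
Proof. by rewrite hconjD hconjN. Qed.

Lemma hconjM x y : hconj (x * y) = hconj y * hconj x.
Proof. hurwitz_ring. Qed.

Lemma hconjK x : hconj (hconj x) = x.
Proof. hurwitz_ring. Qed.

Lemma hconj0 : hconj 0 = 0 :> Hz.
Proof. hurwitz_ring. Qed.

Lemma hconj1 : hconj 1 = 1 :> Hz.
Proof. hurwitz_ring. Qed.

Lemma hconj_sum n (F : 'I_n -> Hz) :
  hconj (\sum_i F i) = \sum_i hconj (F i).
Proof. exact: (big_morph _ hconjD hconj0). Qed.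

Lemma hunitE x : (x \is a GRing.unit) = (qnorm (hval x) == 1).
Proof. by []. Qed.

Lemma hconj_mul x : x \is a GRing.unit -> hconj x * x = 1.
Proof.
rewrite hunitE => /eqP x1; apply: val_inj => /=.
by rewrite qconj_mul x1 scale1r.
Qed.

Lemma hmul_conj x : x \is a GRing.unit -> x * hconj x = 1.
Proof.
rewrite hunitE => /eqP x1; apply: val_inj => /=.
by rewrite qmul_conj x1 scale1r.
Qed.

Lemma qnorm_conj (q : H) : qnorm (qconj q) = qnorm q.
Proof. rewrite /qnorm /=; ring. Qed.

Lemma unit_hconj x : (hconj x \is a GRing.unit) = (x \is a GRing.unit).
Proof. by rewrite !hunitE qnorm_conj. Qed.

Lemma qnorm_eq0 (q : H) : qnorm q = 0 -> q = 0.
Proof.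
case: q => a b c d; rewrite /qnorm /= => h.
have a0 := sqr_ge0 a; have b0 := sqr_ge0 b.
have c0 := sqr_ge0 c; have d0 := sqr_ge0 d.
by apply: quatP => /=; apply/eqP; rewrite -sqrf_eq0; apply/eqP; lra.
Qed.

Lemma hnorm_nat x : exists m : nat, qnorm (hval x) = m%:R.
Proof.
have [m e] := hurwitz_norm_int x.
have := qnorm_ge0 (hval x); rewrite e ler0z.
by case: m e => // m e _; exists m.
Qed.

Lemma qreD (p q : H) : qre (p + q) = qre p + qre q.
Proof. by []. Qed.

Lemma qre_sum n (F : 'I_n -> H) : qre (\sum_i F i) = \sum_i qre (F i).
Proof. exact: (big_morph (@qre R) qreD). Qed.

Lemma hval_sum n (F : 'I_n -> Hz) : hval (\sum_i F i) = \sum_i hval (F i).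
Proof. exact: (big_morph (@hval R)). Qed.

End HurwitzArithmetic.

Lemma int_parity (b : int) : exists m (e : bool), b = 2 * m + e%:R.
Proof.
exists (b %/ 2)%Z, ((b %% 2)%Z == 1); rewrite mulrC {1}(divz_eq b 2); congr (_ + _).
have := ltz_pmod b (isT : 0 < 2 :> int); have := modz_ge0 b (isT : 2 != 0 :> int).
by case: (b %% 2)%Z => // -[|[|?]].
Qed.

Section HalfUnits.
Variable R : realType.
Local Notation Hz := (hurwitz R).
Implicit Types a : Hz.

Lemma hval_mulrz a (m : int) : hval (a *~ m) = m%:~R *: hval a.
Proof. by rewrite -qmulrz; exact: (raddfMz (\val : Hz -> quat R)). Qed.

(** The Hurwitz units of order 6, which are those of real part 1/2.  Both [a] and
    [1 - a] are then units, so [1 - a] is a legitimate reflection parameter whose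
    coefficient [1 - (1 - a) = a] is invertible. *)
Definition half_unit a := hconj a * a = 1 /\ a + hconj a = 1.

Lemma half_unit_conj a : half_unit a -> hconj a = 1 - a.
Proof. by case=> _ <-; rewrite addrAC subrr add0r. Qed.

Lemma half_unit_sqr a : half_unit a -> a * a = a - 1.
Proof.
move=> ha; have [aa _] := ha.
by rewrite -[X in _ - X]aa (half_unit_conj ha) mulrBl mul1r subKr.
Qed.

Lemma half_unit_unit a : half_unit a -> a \is a GRing.unit.
Proof.
case=> /(congr1 (fun t => qnorm (hval t))) /= + _.
rewrite qnormM qnorm_conj qnorm1 -expr2 hunitE => /eqP.
rewrite sqrf_eq1 => /orP[//|/eqP e].
by have := qnorm_ge0 (hval a); rewrite e oppr_ge0 ler10.
Qed.

Lemma half_unit_compl a : half_unit a -> 1 - a \is a GRing.unit.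
Proof.
by move=> ha; rewrite -(half_unit_conj ha) unit_hconj; apply: half_unit_unit.
Qed.

Lemma hurwitzp_hcoord (a b c d : int) : hurwitzp (hcoord R a b c d).
Proof. by apply/hurwitzP; exists a, b, c, d. Qed.

Definition hcoordz (x y z t : int) : Hz := Hurwitz (hurwitzp_hcoord x y z t).

End HalfUnits.

(** * The Hermitian form, automorphisms and short reflections *)

Section Forms.
Variables (R : realType) (n : nat).
Local Notation H := (quat R).
Local Notation Hz := (hurwitz R).
Local Notation L := (hlat Hz n).
Implicit Types (v w r : L) (a b : Hz).

Lemma sright_mul v a b : sright (sright v a) b = sright v (a * b).
Proof.
case: v => x [m k] /=; congr (_, _); last by rewrite !mulrA.
by apply/colP => i; rewrite !mxE mulrA.
Qed.

Lemma srightD v a b : sright v (a + b) = sright v a + sright v b.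
Proof.
case: v => x [m k] /=; rewrite !mulrDr; congr (_, _).
by apply/colP => i; rewrite !mxE mulrDr.
Qed.

Lemma srightDl v w a : sright (v + w) a = sright v a + sright w a.
Proof.
case: v w => x [m k] [y [p q]] /=; congr (_, (_, _)); rewrite ?mulrDl//.
by apply/colP => i; rewrite !mxE mulrDl.
Qed.

Lemma sright1 v : sright v 1 = v.
Proof.
case: v => x [m k] /=; rewrite !mulr1; congr (_, _).
by apply/colP => i; rewrite !mxE mulr1.
Qed.

Lemma sright0 v : sright v 0 = 0.
Proof. by apply: (addrI (sright v 0)); rewrite -srightD !addr0. Qed.

Lemma srightN v a : sright v (- a) = - sright v a.
Proof. by apply: (addrI (sright v a)); rewrite -srightD !subrr sright0. Qed.

Lemma srightB v a b : sright v (a - b) = sright v a - sright v b.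
Proof. by rewrite srightD srightN. Qed.

Lemma srightN1 v : sright v (-1) = - v.
Proof. by rewrite srightN sright1. Qed.

Lemma lformDr v w r : lform v (w + r) = lform v w + lform v r.
Proof.
rewrite /lform /hform /dot /hyp /= !mulrDr [X in _ + X]addrACA.
rewrite [RHS]addrACA; congr (_ + _).
by rewrite -big_split; apply: eq_bigr => i _; rewrite mxE mulrDr.
Qed.

Lemma lformZr v w a : lform v (sright w a) = lform v w * a.
Proof.
case: w => x [m k]; rewrite /lform /hform /dot /hyp /= !mulrDl !mulrA.
by rewrite mulr_suml; congr (_ + _); apply: eq_bigr => i _; rewrite mxE mulrA.
Qed.

Lemma lformC v w : hconj (lform v w) = lform w v.
Proof.
rewrite /lform /hform /dot /hyp !hconjD !hconjM !hconjK hconj_sum.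
rewrite [in X in _ + X]addrC; congr (_ + _).
by apply: eq_bigr => i _; rewrite hconjM hconjK.
Qed.

Lemma lformDl v w r : lform (v + w) r = lform v r + lform w r.
Proof. by rewrite -lformC lformDr hconjD !lformC. Qed.

Lemma lformZl v w a : lform (sright v a) w = hconj a * lform v w.
Proof. by rewrite -lformC lformZr hconjM lformC. Qed.

Lemma lformNr v w : lform v (- w) = - lform v w.
Proof. by rewrite -srightN1 lformZr mulrN1. Qed.

Lemma lformNl v w : lform (- v) w = - lform v w.
Proof. by rewrite -lformC lformNr hconjN lformC. Qed.

Lemma lformBr v w r : lform v (w - r) = lform v w - lform v r.
Proof. by rewrite lformDr lformNr. Qed.

Lemma lformBl v w r : lform (v - w) r = lform v r - lform w r.
Proof. by rewrite lformDl lformNl. Qed.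

Lemma lform_reflection xi r v : lform r r = 1 ->
  lform r (reflection xi r v) = xi * lform r v.
Proof.
by move=> r1; rewrite /reflection lformBr lformZr r1 mul1r mulrBl mul1r subKr.
Qed.

(** The [xi]-reflection multiplies the component along [r] by [xi], so the
    reflections in a fixed [r] compose like their parameters. *)
Lemma reflectionM xi xi' r v : lform r r = 1 ->
  reflection xi' r (reflection xi r v) = reflection (xi' * xi) r v.
Proof.
move=> r1; rewrite {1}/reflection lform_reflection// /reflection -addrA.
rewrite -opprD -srightD; congr (_ - sright _ _).
by rewrite !mulrBl !mul1r mulrA addrA subrK.
Qed.

Lemma reflection1 r v : reflection 1 r v = v.
Proof. by rewrite /reflection subrr mul0r sright0 subr0. Qed.

Lemma AutL_id : AutL (@id L).
Proof. by split=> //; exists id. Qed.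

Lemma AutL_comp (f g : L -> L) : AutL f -> AutL g -> AutL (f \o g).
Proof.
move=> [bf af sf lf] [bg ag sg lg]; split=> /=.
- exact: bij_comp.
- by move=> v w; rewrite /= ag af.
- by move=> v a; rewrite sg sf.
- by move=> v w; rewrite lf lg.
Qed.

Lemma AutL_inv (f g : L -> L) :
  AutL f -> cancel f g -> cancel g f -> AutL g.
Proof.
move=> [bf af sf lf] fg gf; split.
- by exists f.
- by move=> v w; rewrite -{1}[v]gf -{1}[w]gf -af fg.
- by move=> v a; rewrite -{1}[v]gf -sf fg.
- by move=> v w; rewrite -lf !gf.
Qed.

Lemma AutL_exists_inv (f : L -> L) : AutL f ->
  exists g, [/\ AutL g, cancel f g & cancel g f].
Proof.
by move=> fA; have [[g fg gf] _ _ _] := fA; exists g; split=> //; exact: AutL_inv fg gf.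
Qed.

Lemma subgroup_AutL_AutL : subgroup_AutL (@AutL R n).
Proof.
split; [by []|exact: AutL_id|exact: AutL_comp|].
by move=> f g fA fg gf; apply: AutL_inv fA fg gf.
Qed.

Lemma AutLB (f : L -> L) v w : AutL f -> f (v - w) = f v - f w.
Proof.
move=> [_ af sf _]; rewrite af; congr (_ + _).
by rewrite -!srightN1 sf.
Qed.

Lemma AutL_reflection xi r : xi \is a GRing.unit -> lform r r = 1 ->
  AutL (reflection xi r).
Proof.
move=> xiU r1; split.
- exists (reflection xi^-1 r) => v.
    by rewrite reflectionM// mulVr// reflection1.
  by rewrite reflectionM// divrr// reflection1.
- move=> v w; rewrite /reflection lformDr mulrDr srightD opprD.
  by rewrite addrACA.
- move=> v a; rewrite /reflection srightDl lformZr mulrA -[RHS]addrC.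
  rewrite -sright_mul addrC; congr (_ + _).
  by rewrite -!srightN1 !sright_mul mulrN1 mulN1r.
- move=> v w; rewrite /reflection !(lformBl, lformBr, lformZl, lformZr) r1.
  rewrite -(lformC r v) !hconjM hconjB hconj1 mul1r -addrA -opprD.
  set t := lform r v; set s := lform r w.
  rewrite !mulrBl mul1r subKr [hconj t * (1 - _)]mulrBr mulr1 mulrBl.
  rewrite mulrBr addrA subrK.
  by rewrite -mulrA [_ * (xi * s)]mulrA hconj_mul// mul1r subrr subr0.
Qed.

Lemma Reflec0_AutL (g : L -> L) : Reflec0 g -> AutL g.
Proof.
apply; split; first exact: subgroup_AutL_AutL.
by move=> _ [xi [r [xiU _ r1 ->]]]; exact: AutL_reflection.
Qed.

Lemma Reflec0_id : Reflec0 (@id L).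
Proof. by move=> G [[]]. Qed.

Lemma Reflec0_comp (f g : L -> L) : Reflec0 f -> Reflec0 g -> Reflec0 (f \o g).
Proof.
move=> Rf Rg G GP; have [[_ _ c _] _] := GP; apply: c; [exact: Rf|exact: Rg].
Qed.

Lemma Reflec0_inv (f g : L -> L) :
  Reflec0 f -> cancel f g -> cancel g f -> Reflec0 g.
Proof. move=> Rf fg gf G GP; have [[_ _ _ c] _] := GP; apply: c fg gf; exact: Rf. Qed.

(** The parameter [xi = 1] is harmless, because that reflection is the identity;
    later parameters need no check of being different from 1. *)
Lemma Reflec0_reflection xi r : xi \is a GRing.unit -> lform r r = 1 ->
  Reflec0 (reflection xi r).
Proof.
move=> xiU r1; have [->|xi1] := eqVneq xi 1.
  have -> : reflection 1 r = id by apply/funext => v; exact: reflection1.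
  exact: Reflec0_id.
by move=> G [_]; apply; exists xi, r.
Qed.

Lemma AutL_conj_reflection (g g' : L -> L) xi r : AutL g -> cancel g' g ->
  g \o reflection xi r \o g' = reflection xi (g r).
Proof.
move=> gA g'K; apply/funext => v /=; rewrite /reflection AutLB// g'K.
by have [_ _ sg lg] := gA; rewrite sg -(lg r (g' v)) g'K.
Qed.

(** [Reflec0] is normal: an automorphism [g] carries the reflection in [r] to
    the reflection in [g r], so the elements whose conjugate stays in [Reflec0]
    form a subgroup containing the generators. *)
Lemma Reflec0_conj (g g' s : L -> L) : AutL g -> cancel g g' -> cancel g' g ->
  Reflec0 s -> Reflec0 (g \o s \o g').
Proof.
move=> gA gK g'K.
suff : (@Reflec0 R n) `<=` [set s | AutL s /\ Reflec0 (g \o s \o g')].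
  by move=> sub /sub[].
apply: smallest_sub.
  split.
  - by move=> f [].
  - split; first exact: AutL_id.
    have -> : g \o id \o g' = id by apply/funext => v /=; rewrite g'K.
    exact: Reflec0_id.
  - move=> f h [fA fR] [hA hR]; split; first exact: AutL_comp.
    have -> : g \o (f \o h) \o g' = (g \o f \o g') \o (g \o h \o g').
      by apply/funext => v /=; rewrite gK.
    exact: Reflec0_comp.
  - move=> f h [fA fR] fh hf; split; first exact: AutL_inv fh hf.
    by apply: Reflec0_inv fR _ _ => v /=; rewrite gK (fh, hf) g'K.
move=> _ [xi [r [xiU _ r1 ->]]]; split; first exact: AutL_reflection.
rewrite (AutL_conj_reflection _ _ gA g'K); apply: Reflec0_reflection => //.
by have [_ _ _ ->] := gA.
Qed.

End Forms.

(** * Central translations *)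

Section ExplicitElements.
Variables (R : realType) (n : nat).
Local Notation H := (quat R).
Local Notation Hz := (hurwitz R).
Local Notation L := (hlat Hz n).
Implicit Types (v w r : L) (a b p q : Hz) (i : 'I_n).

Definition evec i a : 'cV[Hz]_n := \col_k (if k == i then a else 0).

Definition rho : L := (0, (0, 1)).
Definition sigma : L := (0, (1, 0)).

Lemma dot_evec i a x : dot (@hconj R) (evec i a) x = hconj a * x i 0.
Proof.
rewrite /dot (bigD1 i)//= mxE eqxx big1 ?addr0// => k ki.
by rewrite mxE (negPf ki) hconj0 mul0r.
Qed.

Lemma scol_evec i a b : scol (evec i a) b = evec i (a * b).
Proof. by apply/colP => k; rewrite !mxE; case: eqP; rewrite ?mul0r. Qed.

Lemma dot0 x : dot (@hconj R) (0 : 'cV[Hz]_n) x = 0.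
Proof. by rewrite /dot big1// => i _; rewrite mxE hconj0 mul0r. Qed.

Lemma scol0 a : scol (0 : 'cV[Hz]_n) a = 0.
Proof. by apply/colP => i; rewrite !mxE mul0r. Qed.

Lemma lform_evec i p q : lform (evec i 1, (p, q)) (evec i 1, (p, q)) =
  1 + (hconj p * q + hconj q * p).
Proof. by rewrite /lform /hform /hyp /= dot_evec mxE eqxx hconj1 mulr1. Qed.

Lemma lform_hyp p q : lform (0 : 'cV[Hz]_n, (p, q)) (0, (p, q)) =
  hconj p * q + hconj q * p.
Proof. by rewrite /lform /hform /hyp /= dot0 add0r. Qed.

Lemma reflection_evec xi i p q (x : 'cV[Hz]_n) m k :
  let t := (1 - xi) * (x i 0 + (hconj p * k + hconj q * m)) in
  reflection xi (evec i 1, (p, q)) (x, (m, k)) = (x - evec i t, (m - p * t, k - q * t)).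
Proof.
move=> t; rewrite /reflection /lform /hform /hyp /= dot_evec hconj1 mul1r.
by rewrite scol_evec mul1r.
Qed.

Lemma reflection_hyp xi p q (x : 'cV[Hz]_n) m k :
  let t := (1 - xi) * (hconj p * k + hconj q * m) in
  reflection xi (0, (p, q)) (x, (m, k)) = (x : 'cV[Hz]_n, (m - p * t, k - q * t)).
Proof.
move=> t; rewrite /reflection /lform /hform /hyp /= dot0 add0r scol0.
by congr (_, _); exact: subr0.
Qed.

Lemma Reflec0_evec xi i p q : xi \is a GRing.unit -> hconj p * q + hconj q * p = 0 ->
  Reflec0 (reflection xi (evec i 1, (p, q))).
Proof. by move=> xiU e; apply: Reflec0_reflection; rewrite // lform_evec e addr0. Qed.

Lemma Reflec0_hyp xi p q : xi \is a GRing.unit -> hconj p * q + hconj q * p = 1 ->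
  Reflec0 (reflection xi (0 : 'cV[Hz]_n, (p, q))).
Proof. by move=> xiU e; apply: Reflec0_reflection; rewrite // lform_hyp. Qed.

(** The central translation [T_{0,z}] of the lattice. *)
Definition ctrans z v : L := (v.1, (v.2.1, v.2.2 + z * v.2.1)).

Lemma ctransD a b v : ctrans a (ctrans b v) = ctrans (a + b) v.
Proof. by case: v => x [m k]; rewrite /ctrans /= mulrDl -addrA (addrC (b * m)). Qed.

Lemma ctrans0 v : ctrans 0 v = v.
Proof. by case: v => x [m k]; rewrite /ctrans /= mul0r addr0. Qed.

Lemma ctransK a : cancel (ctrans a) (ctrans (- a)).
Proof. by move=> v; rewrite ctransD addNr ctrans0. Qed.

Lemma ctransNK a : cancel (ctrans (- a)) (ctrans a).
Proof. by move=> v; rewrite ctransD addrN ctrans0. Qed.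

Lemma AutL_ctrans z : hconj z = - z -> AutL (ctrans z).
Proof.
move=> zi; split.
- by exists (ctrans (- z)); [exact: ctransK|exact: ctransNK].
- move=> [x [m k]] [y [p q]]; rewrite /ctrans /=; congr (_, (_, _)).
  by rewrite mulrDr addrACA.
- by move=> [x [m k]] a; rewrite /ctrans /= mulrDl mulrA.
- move=> [x [m k]] [y [p q]]; rewrite /ctrans /lform /hform /hyp /=.
  congr (_ + _); rewrite mulrDr hconjD hconjM zi mulrDl mulrN mulNr -!mulrA.
  by rewrite [X in _ + X]addrC addrA addrK.
Qed.

(** All three roots are [e_i] modulo [rho], so on [rho^perp / rho] the product
    multiplies the [i]-th coordinate by [a^2 conj(a)^2 = 1] and leaves the others
    alone.  The component of the second root along [rho] is chosen so that
    [sigma], which the first reflection moves off the hyperbolic plane, comes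
    back to it. *)
Lemma Reflec0_ctrans_half i a : half_unit a -> Reflec0 (ctrans (hconj a - a)).
Proof.
move=> ha; have aU := half_unit_unit ha; have aU' := half_unit_compl ha.
have -> : ctrans (hconj a - a) = reflection (a * a) (evec i 1, (0, 0)) \o
    (reflection (1 - a) (evec i 1, (0, - a)) \o reflection (1 - a) (evec i 1, (0, 1))).
  apply/funext => -[x [m k]] /=.
  have hN : hconj (- a) = a - 1 by rewrite hconjN (half_unit_conj ha) opprB.
  have aa := half_unit_sqr ha.
  rewrite [reflection (1 - a) (_, (0, 1)) _]reflection_evec subKr.
  rewrite hconj0 hconj1 !mul0r add0r !mul1r subr0.
  rewrite [reflection (1 - a) _ _]reflection_evec subKr hN hconj0 !mul0r add0r subr0.
  rewrite reflection_evec hconj0 !mul0r !addr0 !subr0 /ctrans /= (half_unit_conj ha).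
  rewrite mulNr opprK !mxE !eqxx.
  have haa y : a * (a * y) = a * y - y by rewrite mulrA aa mulrBl mul1r.
  congr (_, (_, _)).
    apply/colP => l; rewrite !mxE; case: eqP => [->|_]; last by rewrite !subr0.
    rewrite !(mulrDr, mulrBr, mulrDl, mulrBl, mul1r, mulrN, mulNr, haa, aa).
    by move: (a * _) (a * m) => y z; hurwitz_ring.
  rewrite !(mulrDr, mulrBr, mulrDl, mulrBl, mul1r, mulrN, mulNr, haa, aa).
  by move: (a * _) (a * m) => y z; hurwitz_ring.
apply: Reflec0_comp; last apply: Reflec0_comp.
all: apply: Reflec0_evec; rewrite ?(unitrMl _ aU)//.
all: by rewrite !(hconj0, mul0r, mulr0, addr0).
Qed.

Lemma Reflec0_ctransD a b : Reflec0 (ctrans a) -> Reflec0 (ctrans b) ->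
  Reflec0 (ctrans (a + b)).
Proof.
move=> Ra Rb; have -> : ctrans (a + b) = ctrans a \o ctrans b.
  by apply/funext => v /=; rewrite ctransD.
exact: Reflec0_comp.
Qed.

Lemma Reflec0_ctransN a : Reflec0 (ctrans a) -> Reflec0 (ctrans (- a)).
Proof. by move=> Ra; apply: Reflec0_inv Ra _ _; [exact: ctransK|exact: ctransNK]. Qed.

Lemma Reflec0_ctransMz a (m : int) : Reflec0 (ctrans a) -> Reflec0 (ctrans (a *~ m)).
Proof.
move=> Ra; have Rm k : Reflec0 (ctrans (a *+ k)).
  elim: k => [|k IHk]; last by rewrite mulrS; exact: Reflec0_ctransD.
  have -> : ctrans (a *+ 0) = id by apply/funext => v; exact: ctrans0.
  exact: Reflec0_id.
by case: m => k; [exact: Rm|exact: Reflec0_ctransN (Rm _)].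
Qed.

(** These are the eight units [(1 +- i +- j +- k)/2]. *)
Lemma half_unit_signs (s1 s2 s3 : bool) :
  half_unit (hcoordz R 1 (- s1%:R) (- s2%:R) (- s3%:R)).
Proof.
by split; apply: val_inj; apply: quatP; case: s1; case: s2; case: s3 => /=; field.
Qed.

Lemma imaginary_hcoordz z : hconj z = - z -> exists b c d : int, z = hcoordz R 0 b c d.
Proof.
move=> /(congr1 (fun t => qre (hval t))) /=.
have /hurwitzP[a [b [c [d e]]]] := valP z; rewrite e /= => h.
have a0 : a = 0 by apply/eqP; rewrite -(intr_eq0 R); apply/eqP; lra.
by exists b, c, d; apply: val_inj => /=; rewrite e a0.
Qed.

Definition icoset_reps : seq Hz :=
  [:: 0; hcoordz R 0 1 0 0; hcoordz R 0 0 1 0; hcoordz R 0 0 0 1].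

(** The imaginary Hurwitz integers are the [b i + c j + d k] with integral
    coefficients.  The vectors [+- i +- j +- k] generate those with [b], [c],
    [d] of equal parity, a subgroup of index 4. *)
Lemma ctrans_coset_rep i z : hconj z = - z ->
  exists2 y, y \in icoset_reps & Reflec0 (ctrans (z - y)).
Proof.
have G s1 s2 s3 := Reflec0_ctrans_half i (half_unit_signs s1 s2 s3).
have G2 s1 s2 s3 := Reflec0_ctransD (G s1 s2 s3) (Reflec0_ctransN (G false false false)).
have even (b c d : int) : Reflec0 (ctrans (hcoordz R 0 (2 * b) (2 * c) (2 * d))).
  have := Reflec0_ctransD (Reflec0_ctransMz b (G2 true false false))
    (Reflec0_ctransD (Reflec0_ctransMz c (G2 false true false))
                     (Reflec0_ctransMz d (G2 false false true))).
  congr (Reflec0 (ctrans _)); apply: val_inj; rewrite /= !hval_mulrz.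
  by apply: quatP; rewrite /= ?intrM; field.
have R0 : Reflec0 (ctrans 0).
  by have := even 0 0 0; congr (Reflec0 (ctrans _)); hurwitz_field.
move=> /imaginary_hcoordz[b [c [d ->]]].
have [b' [e1 ->]] := int_parity b; have [c' [e2 ->]] := int_parity c.
have [d' [e3 ->]] := int_parity d.
suff [y yS Ry] : exists2 y, y \in icoset_reps &
    Reflec0 (ctrans (hcoordz R 0 e1%:R e2%:R e3%:R - y)).
  exists y => //; have := Reflec0_ctransD (even b' c' d') Ry.
  by congr (Reflec0 (ctrans _)); rewrite addrA; congr (_ - y);
     apply: val_inj; apply: quatP; rewrite /= ?intrD ?intrM; field.
(* For instance [i + j = k + (i + j - k)]; the other sums of two units are alike. *)
case: e1; case: e2; case: e3.
- exists 0; first by rewrite !inE eqxx.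
  by have := G true true true; congr (Reflec0 (ctrans _)); hurwitz_field.
- exists (hcoordz R 0 0 0 1); first by rewrite !inE eqxx !orbT.
  by have := G true true false; congr (Reflec0 (ctrans _)); hurwitz_field.
- exists (hcoordz R 0 0 1 0); first by rewrite !inE eqxx !orbT.
  by have := G true false true; congr (Reflec0 (ctrans _)); hurwitz_field.
- exists (hcoordz R 0 1 0 0); first by rewrite !inE eqxx !orbT.
  by move: R0; congr (Reflec0 (ctrans _)); hurwitz_field.
- exists (hcoordz R 0 1 0 0); first by rewrite !inE eqxx !orbT.
  by have := G false true true; congr (Reflec0 (ctrans _)); hurwitz_field.
- exists (hcoordz R 0 0 1 0); first by rewrite !inE eqxx !orbT.
  by move: R0; congr (Reflec0 (ctrans _)); hurwitz_field.
- exists (hcoordz R 0 0 0 1); first by rewrite !inE eqxx !orbT.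
  by move: R0; congr (Reflec0 (ctrans _)); hurwitz_field.
- exists 0; first by rewrite !inE eqxx.
  by move: R0; congr (Reflec0 (ctrans _)); hurwitz_field.
Qed.

(** The set product of the central translations with [Reflec0]; a group because
    [Reflec0] is normal. *)
Definition ctrans_Reflec0 : set (L -> L) :=
  [set g | exists z s, [/\ hconj z = - z, Reflec0 s & g = ctrans z \o s]].
Local Notation G := ctrans_Reflec0.

Lemma ctrans_Reflec0_AutL g : G g -> AutL g.
Proof.
by move=> [z [s [zi sR ->]]]; apply: AutL_comp; [exact: AutL_ctrans|exact: Reflec0_AutL].
Qed.

Lemma ctrans_Reflec0_ctrans z : hconj z = - z -> G (ctrans z).
Proof. by move=> zi; exists z, id; split=> //; exact: Reflec0_id. Qed.

Lemma ctrans_Reflec0_Reflec0 s : Reflec0 s -> G s.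
Proof.
move=> sR; exists 0, s; split; rewrite ?hconj0 ?oppr0//.
by apply/funext => v; rewrite /= ctrans0.
Qed.

Lemma ctrans_Reflec0_comp f g : G f -> G g -> G (f \o g).
Proof.
move=> [z [s [zi sR ->]]] [y [t [yi tR ->]]].
exists (z + y), ((ctrans (- y) \o s \o ctrans y) \o t); split.
- by rewrite hconjD zi yi opprD.
- apply: Reflec0_comp => //.
  apply: Reflec0_conj (ctransNK y) (ctransK y) sR.
  by apply: AutL_ctrans; rewrite hconjN yi.
- by apply/funext => v; rewrite /= ctransD addrK.
Qed.

Lemma ctrans_Reflec0_inv f g : G f -> cancel f g -> cancel g f -> G g.
Proof.
move=> [z [s [zi sR ->]]] fg gf.
have [s' [s'A ss' s's]] := AutL_exists_inv (Reflec0_AutL sR).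
have -> : g = s' \o ctrans (- z).
  by apply/funext => v /=; rewrite -[LHS]ss' -{2}[v]gf /= ctransK.
apply: ctrans_Reflec0_comp.
  by apply: ctrans_Reflec0_Reflec0; exact: Reflec0_inv sR ss' s's.
by apply: ctrans_Reflec0_ctrans; rewrite hconjN zi.
Qed.

End ExplicitElements.

(** * Reflections of the hyperbolic plane and reflections in norm 2 vectors *)

Section Bireflections.
Variables (R : realType) (n : nat).
Local Notation Hz := (hurwitz R).
Local Notation L := (hlat Hz n).
Local Notation G := (@ctrans_Reflec0 R n).
Local Notation rho := (@rho R n).
Local Notation sigma := (@sigma R n).
Implicit Types (v w r l : L) (a b p q : Hz) (i j : 'I_n).

(** For [l] of norm 2 this is the reflection of parameter [-1], whose coefficient
    [2 / <l|l>] is 1. *)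
Definition bireflection l v : L := v - sright l (lform l v).

(** Conjugation by [g] turns the reflection in [l] into the reflection in
    [g l]. *)
Lemma ctrans_Reflec0_bireflection g l : G g ->
  G (bireflection (g l)) -> G (bireflection l).
Proof.
move=> gG bG; have gA := ctrans_Reflec0_AutL gG.
have [g' [g'A gg' g'g]] := AutL_exists_inv gA.
have -> : bireflection l = g' \o (bireflection (g l) \o g).
  apply/funext => v /=; apply: (can_inj gg'); rewrite g'g /bireflection.
  by have [_ _ sg lg] := gA; rewrite AutLB// lg sg.
apply: ctrans_Reflec0_comp; first exact: ctrans_Reflec0_inv gG gg' g'g.
exact: ctrans_Reflec0_comp.
Qed.

Lemma ctrans_Reflec0_cancel h g : G h -> G (h \o g) -> G g.
Proof.
move=> hG hgG; have [h' [h'A hh' h'h]] := AutL_exists_inv (ctrans_Reflec0_AutL hG).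
have -> : g = h' \o (h \o g) by apply/funext => v /=; rewrite hh'.
by apply: ctrans_Reflec0_comp => //; exact: ctrans_Reflec0_inv hG hh' h'h.
Qed.

(** Acting on columns [(mu, nu)], this is the matrix with rows [(2 - a, -a)] and
    [(-a, 0)]; in particular [rho] goes to [- sigma a]. *)
Lemma half_unit_reflection_col a (x : 'cV[Hz]_n) m k : half_unit a ->
  reflection (1 - a) (0, (1, hconj a)) (x, (m, k)) =
  (x, (m + m - a * m - a * k, - (a * m))).
Proof.
move=> ha; rewrite reflection_hyp subKr hconj1 hconjK !mul1r.
have haa y : a * (a * y) = a * y - y.
  by rewrite mulrA (half_unit_sqr ha) mulrBl mul1r.
have haac y : hconj a * (a * y) = y by rewrite mulrA; case: ha => -> _; rewrite mul1r.
congr (_, (_, _)).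
  rewrite !mulrDr haa; by move: (a * m) (a * k) => y z; hurwitz_ring.
by rewrite haac opprD addrA subrr add0r.
Qed.

(** Acting on columns [(mu, nu)], this is the matrix with rows [(0, -b)] and
    [(-b, 2 - b)]; in particular [sigma] goes back to [- rho b]. *)
Lemma half_unit_reflection_row b (x : 'cV[Hz]_n) m k : half_unit b ->
  reflection (1 - b) (0, (1, b)) (x, (m, k)) =
  (x, (- (b * k), k + k - b * k - b * m)).
Proof.
move=> hb; rewrite reflection_hyp subKr hconj1 !mul1r.
have hbb y : b * (b * y) = b * y - y.
  by rewrite mulrA (half_unit_sqr hb) mulrBl mul1r.
have hbbc y : b * (hconj b * y) = y.
  by rewrite mulrA (hmul_conj (half_unit_unit hb)) mul1r.
congr (_, (_, _)).
  by rewrite mulrDr hbbc opprD addrCA subrr addr0.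
rewrite !mulrDr hbbc hbb; by move: (b * m) (b * k) => y z; hurwitz_ring.
Qed.

Lemma Reflec0_half_hyp a : half_unit a ->
  Reflec0 (reflection (1 - a) (0 : 'cV[Hz]_n, (1, a))).
Proof.
move=> ha; apply: Reflec0_hyp; first exact: half_unit_compl.
by rewrite hconj1 mul1r mulr1; case: ha.
Qed.

Lemma half_unit_hconj a : half_unit a -> half_unit (hconj a).
Proof.
move=> ha; split; last by rewrite hconjK addrC; case: ha.
by rewrite hconjK hmul_conj//; exact: half_unit_unit.
Qed.

Lemma Reflec0_half_hyp_conj a : half_unit a ->
  Reflec0 (reflection (1 - a) (0 : 'cV[Hz]_n, (1, hconj a))).
Proof.
move=> ha; apply: Reflec0_hyp; first exact: half_unit_compl.
by rewrite hconj1 hconjK mul1r mulr1 addrC; case: ha.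
Qed.

(** Let [M_a] be the matrix of [half_unit_reflection_col] and [N_b] that of
    [half_unit_reflection_row].  Composing the reflection in [(0;1,1)], which is
    [(mu,nu) |-> (-nu,-mu)], with [M_c] gives a lower triangular matrix with
    diagonal [c, c]; so does [N_b M_a], with diagonal [b a, b a].  Since
    [c = a1 a2] can have order 6 together with [a1] and [a2], the two products
    for this [c] differ by a central translation.  The third factor below is the
    inverse of [M_c], hence its parameter [a3 = conj c]. *)
Lemma ctrans_Reflec0_swap_hyp : G (bireflection (0, (1, 1))).
Proof.
pose a1 := hcoordz R 1 0 0 0; pose a2 := hcoordz R 1 0 (-1) (-1).
pose a3 := hconj (hcoordz R 1 0 0 (-1)).
have h1 : half_unit a1 by exact: (half_unit_signs R false false false).
have h2 : half_unit a2 by exact: (half_unit_signs R false true true).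
have h3 : half_unit a3 by exact: half_unit_hconj (half_unit_signs R false false true).
(* The difference of the off-diagonal entries, divided by [c]: [i - j - k]. *)
pose z := hcoordz R 0 1 (-1) (-1).
have -> : bireflection (0, (1, 1)) = ctrans z \o
  (reflection (1 - a1) (0, (1, a1)) \o (reflection (1 - a2) (0, (1, hconj a2)) \o
   reflection (1 - a3) (0, (1, a3)))).
  apply/funext => -[x [m k]] /=.
  rewrite (half_unit_reflection_row x m k h3).
  rewrite (half_unit_reflection_col _ _ _ h2).
  rewrite (half_unit_reflection_row _ _ _ h1).
  rewrite /bireflection /lform /hform /hyp /ctrans /= dot0 scol0 hconj1 !mul1r add0r.
  congr (_, (_, _)); first exact: subr0.
    by hurwitz_field.
  by hurwitz_field.
apply: ctrans_Reflec0_comp; first by apply: ctrans_Reflec0_ctrans; hurwitz_field.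
apply: ctrans_Reflec0_Reflec0; apply: Reflec0_comp; first exact: Reflec0_half_hyp.
by apply: Reflec0_comp; [exact: Reflec0_half_hyp_conj|exact: Reflec0_half_hyp].
Qed.

End Bireflections.

(** * Automorphisms fixing the hyperbolic plane *)

Section FrameStabilizer.
Variables (R : realType) (n : nat).
Local Notation Hz := (hurwitz R).
Local Notation L := (hlat Hz n).
Local Notation G := (@ctrans_Reflec0 R n).
Local Notation rho := (@rho R n).
Local Notation sigma := (@sigma R n).
Implicit Types (v w r l : L) (a b p q : Hz) (i j : 'I_n).

Definition ebasis i : L := (evec i 1, (0, 0)).

Lemma lform_ebasis i v : lform (ebasis i) v = v.1 i 0.
Proof.
by rewrite /lform /hform /hyp /= dot_evec hconj1 mul1r !hconj0 !mul0r !addr0.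
Qed.

Lemma lform_rho v : lform rho v = v.2.1.
Proof.
by rewrite /lform /hform /hyp /= dot0 hconj1 mul1r hconj0 mul0r !add0r.
Qed.

Lemma lform_sigma v : lform sigma v = v.2.2.
Proof.
by rewrite /lform /hform /hyp /= dot0 hconj1 mul1r hconj0 mul0r add0r addr0.
Qed.

Lemma lformE v w : lform v w = (\sum_i hconj (v.1 i 0) * w.1 i 0) +
  (hconj v.2.1 * w.2.2 + hconj v.2.2 * w.2.1).
Proof. by []. Qed.

Lemma reflection_fix xi r v : lform r v = 0 -> reflection xi r v = v.
Proof. by move=> e; rewrite /reflection e mulr0 sright0 subr0. Qed.

Lemma bireflection_fix l v : lform l v = 0 -> bireflection l v = v.
Proof. by move=> e; rewrite /bireflection e sright0 subr0. Qed.

(** A reflection in a root [(e_i;0,w)], which fixes [rho]; [w] is the solution of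
    [a (x_i + conj w) = x_i]. *)
Lemma Reflec0_clear_coord i x k : exists2 s : L -> L, Reflec0 s &
  s rho = rho /\ exists k', s (x, (1, k)) = (x - evec i (x i 0), (1, k')).
Proof.
have ha := half_unit_signs R false false false; set a := hcoordz _ _ _ _ _ in ha.
have aU := half_unit_unit ha; have aU' := half_unit_compl ha.
pose w := hconj ((hconj a - 1) * x i 0).
exists (reflection (1 - a) (evec i 1, (0, w))).
  by apply: Reflec0_evec => //; rewrite hconj0 mul0r mulr0 addr0.
split.
  apply: reflection_fix.
  by rewrite /lform /hform /hyp /= dot_evec mxE hconj0 mul0r !mulr0 !addr0.
rewrite reflection_evec subKr hconj0 !mul0r add0r mulr1 subr0 hconjK.
have -> : a * (x i 0 + (hconj a - 1) * x i 0) = x i 0.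
  by rewrite mulrBl mul1r addrC subrK mulrA hmul_conj// mul1r.
by exists (k - w * x i 0).
Qed.

Lemma Reflec0_clear x k : exists2 s : L -> L, Reflec0 s &
  s rho = rho /\ exists k', s (x, (1, k)) = (0, (1, k')).
Proof.
suff H d : (d <= n)%N -> exists2 s : L -> L, Reflec0 s & s rho = rho /\
    exists y k', s (x, (1, k)) = (y, (1, k')) /\
                 forall i, (i < d)%N -> y i 0 = 0.
  have [s sR [srho [y [k' [e y0]]]]] := H n (leqnn n); exists s => //; split=> //.
  exists k'; rewrite e; congr (_, _); apply/colP => i; rewrite mxE y0//.
elim: d => [_|d IHd dn].
  exists id; first exact: Reflec0_id.
  by split=> //; exists x, k.
have [s sR [srho [y [k' [e y0]]]]] := IHd (ltnW dn).
have [t tR [trho [k2 e2]]] := Reflec0_clear_coord (Ordinal dn) y k'.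
exists (t \o s); first exact: Reflec0_comp.
split; first by rewrite /= srho.
exists (y - evec (Ordinal dn) (y (Ordinal dn) 0)), k2; rewrite /= e e2; split=> // i.
rewrite ltnS leq_eqVlt => /orP[/eqP id|ilt].
  have -> : i = Ordinal dn by exact: val_inj.
  by rewrite !mxE eqxx subrr.
by rewrite !mxE (y0 i ilt) sub0r; case: eqP ilt => [->|_ _]; [rewrite ltnn|exact: oppr0].
Qed.

(** It suffices to carry [e_i - e_j] to [(0;1,1)] inside the group.  A first
    reflection gives it height 1, [Reflec0_clear] then makes its [Lambda]
    component vanish, and the resulting [(0;1,k)] still has norm 2, so that
    [1 - k] is imaginary and a central translation finishes. *)
Lemma ctrans_Reflec0_swap i j : i != j -> G (bireflection (ebasis i - ebasis j)).
Proof.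
move=> ij.
have l2 : lform (ebasis i - ebasis j) (ebasis i - ebasis j) = 1 + 1.
  rewrite lformBl !lform_ebasis /= !mxE !eqxx (negPf ij) eq_sym (negPf ij).
  by rewrite subr0 sub0r opprK.
have ha := half_unit_signs R false false false; set a := hcoordz _ _ _ _ _ in ha.
have aU := half_unit_unit ha; have aU' := half_unit_compl ha.
pose g1 : L -> L := reflection (1 - a) (evec i 1, (- hconj a, 0)).
have g1R : Reflec0 g1.
  by apply: Reflec0_evec => //; rewrite hconj0 mul0r mulr0 addr0.
have [y [k1 e1]] : exists y k1, g1 (ebasis i - ebasis j) = (y, (1, k1)).
  rewrite /g1 /ebasis; have -> : (evec i 1, (0, 0)) - (evec j 1, (0, 0)) =
    (evec i 1 - evec j 1, (0, 0)) :> L by congr (_, (_, _)); rewrite /= subrr.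
  rewrite reflection_evec subKr hconj0 mul0r mulr0 !addr0.
  rewrite !mxE eqxx (negPf ij) subr0 mulr1 sub0r mulNr opprK.
  by rewrite hconj_mul//; eexists; eexists.
have [s sR [_ [k e]]] := Reflec0_clear y k1.
have gR : Reflec0 (s \o g1) by exact: Reflec0_comp.
have gA := Reflec0_AutL gR.
have kk : k + hconj k = 1 + 1.
  have [_ _ _ lg] := gA; move: l2; rewrite -lg /= e1 e lformE /=.
  rewrite big1 => [|q _]; last by rewrite mxE mulr0.
  by rewrite hconj1 mul1r mulr1 add0r.
have zi : hconj (1 - k) = - (1 - k).
  by rewrite hconjB hconj1 opprB; apply/eqP; rewrite subr_eq addrAC -subr_eq opprK kk.
apply: (@ctrans_Reflec0_bireflection _ _ (ctrans (1 - k) \o (s \o g1))).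
  apply: ctrans_Reflec0_comp; first exact: ctrans_Reflec0_ctrans.
  exact: ctrans_Reflec0_Reflec0.
rewrite /= e1 e /ctrans /= mulr1 addrC subrK.
exact: ctrans_Reflec0_swap_hyp.
Qed.

(** The form is nondegenerate: pairing with the frame reads off all coordinates. *)
Lemma AutL_frame_id (g : L -> L) : AutL g -> g rho = rho -> g sigma = sigma ->
  (forall i, g (ebasis i) = ebasis i) -> g = id.
Proof.
move=> [_ _ _ lg] gr gs ge; apply/funext => v.
have e1 : (g v).1 = v.1.
  by apply/colP => i; rewrite -!lform_ebasis -[in LHS]ge lg.
have e2 : (g v).2.1 = v.2.1 by rewrite -!lform_rho -[in LHS]gr lg.
have e3 : (g v).2.2 = v.2.2 by rewrite -!lform_sigma -[in LHS]gs lg.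
by case: (g v) e1 e2 e3 => x [m k] /= -> -> ->; case: v => ? [].
Qed.

(** Norms of Hurwitz integers are natural numbers, so in a sum equal to 1 a
    single term is nonzero. *)
Lemma unit_vector (y : 'cV[Hz]_n) : \sum_i hconj (y i 0) * y i 0 = 1 ->
  exists j u, u \is a GRing.unit /\ y = evec j u.
Proof.
move=> /(congr1 (fun t => qre (hval t))).
rewrite hval_sum qre_sum /= => e.
have e1 : \sum_i qnorm (hval (y i 0)) = 1.
  by rewrite -e; apply: eq_bigr => i _; rewrite /qnorm /=; ring.
have [j yj] : exists j, y j 0 != 0.
  apply/existsP; apply: contraPT e1 => /existsPn y0.
  rewrite big1 => [|i _]; first by move/eqP; rewrite eq_sym oner_eq0.
  by have := y0 i; rewrite negbK => /eqP ->; rewrite /qnorm /=; ring.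
move: e1; rewrite (bigD1 j)//=.
have [[|m] em] := hnorm_nat (y j 0).
  by case/eqP: yj; apply: val_inj; exact: qnorm_eq0.
have s0 : 0 <= \sum_(i | i != j) qnorm (hval (y i 0)).
  by apply: sumr_ge0 => i _; exact: qnorm_ge0.
rewrite em -natr1 => e1.
have m0 : 0 <= m%:R :> R by [].
have mm : m%:R = 0 :> R by lra.
have ss : \sum_(i | i != j) qnorm (hval (y i 0)) = 0 by lra.
exists j, (y j 0); split; first by rewrite hunitE em -natr1 mm add0r.
apply/colP => i; rewrite mxE; case: eqP => [->//|/eqP ij].
apply: val_inj; apply: qnorm_eq0.
by apply: (psumr_eq0P _ ss) => // l _; exact: qnorm_ge0.
Qed.

(** The basis vectors are straightened one at a time, from the last index down:
    [g e_i] is a norm 1 vector of [Lambda], hence [e_j u]; a transposition moves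
    [e_j] to [e_i] and a reflection in [e_i] removes the unit. *)
Lemma ctrans_Reflec0_frame (g : L -> L) :
  AutL g -> g rho = rho -> g sigma = sigma -> G g.
Proof.
suff H d : (d <= n)%N -> forall g : L -> L, AutL g -> g rho = rho -> g sigma = sigma ->
    (forall i, (d <= i)%N -> g (ebasis i) = ebasis i) -> G g.
  move=> gA gr gs; apply: (H n) => // i; by rewrite leqNgt ltn_ord.
elim: d => [_|d IHd dn] {}g gA gr gs ge.
  rewrite (AutL_frame_id gA gr gs) => [|i]; last exact: ge.
  by apply: ctrans_Reflec0_Reflec0; exact: Reflec0_id.
pose i := Ordinal dn.
have [_ _ sg lg] := gA.
have ger : (g (ebasis i)).2.1 = 0 by rewrite -lform_rho -gr lg lform_rho.
have ges : (g (ebasis i)).2.2 = 0 by rewrite -lform_sigma -gs lg lform_sigma.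
have [j [u [uU eu]]] : exists j u, u \is a GRing.unit /\ (g (ebasis i)).1 = evec j u.
  apply: unit_vector; have := lg (ebasis i) (ebasis i).
  by rewrite lform_ebasis mxE eqxx lformE ger ges !mulr0 !addr0.
have u0 : u != 0 by apply: contraTneq uU => ->; rewrite unitr0.
have gi : g (ebasis i) = sright (ebasis j) u.
  rewrite /= scol_evec mul1r !mul0r -eu -{1}ger -ges.
  by case: (g _) => ? [].
have ij : (j <= i)%N.
  rewrite leqNgt; apply/negP => lij; have := ge j lij => gj.
  have := lg (ebasis j) (ebasis i); rewrite gj !lform_ebasis eu !mxE eqxx.
  by case: eqP lij => [->|_ _ /eqP]; [rewrite ltnn|rewrite (negPf u0)].
have [h [hG hA hr hs] [hj hl]] : exists2 h : L -> L,
    [/\ G h, AutL h, h rho = rho & h sigma = sigma] &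
    h (ebasis j) = ebasis i /\ forall l : 'I_n, (i < l)%N -> h (ebasis l) = ebasis l.
  have [->|ji] := eqVneq j i.
    exists id => //; split=> //; [|exact: AutL_id].
    by apply: ctrans_Reflec0_Reflec0; exact: Reflec0_id.
  have hG : G (bireflection (ebasis i - ebasis j)).
    by apply: ctrans_Reflec0_swap; rewrite eq_sym.
  exists (bireflection (ebasis i - ebasis j)).
    split=> //; first exact: ctrans_Reflec0_AutL.
      by apply: bireflection_fix; rewrite lformBl !lform_ebasis /= !mxE subrr.
    by apply: bireflection_fix; rewrite lformBl !lform_ebasis /= !mxE subrr.
  split.
    rewrite /bireflection lformBl !lform_ebasis !mxE eqxx eq_sym (negPf ji) sub0r.
    by rewrite srightN1 opprK addrC subrK.
  move=> l il; apply: bireflection_fix; rewrite lformBl !lform_ebasis !mxE.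
  case: eqP il => [->|_ il]; first by rewrite ltnn.
  case: eqP il => [<- /(leq_ltn_trans ij)|_ _]; first by rewrite ltnn.
  exact: subrr.
pose k : L -> L := reflection (hconj u) (ebasis i).
have kG : G k.
  apply: ctrans_Reflec0_Reflec0; apply: Reflec0_reflection.
    by rewrite unit_hconj.
  by rewrite lform_ebasis mxE eqxx.
have kA := ctrans_Reflec0_AutL kG.
apply: (ctrans_Reflec0_cancel hG); apply: (ctrans_Reflec0_cancel kG).
apply: IHd (ltnW dn) _ _ _ _ _.
- by apply: AutL_comp => //; exact: AutL_comp.
- by rewrite /= gr hr; apply: reflection_fix; rewrite lform_ebasis mxE.
- by rewrite /= gs hs; apply: reflection_fix; rewrite lform_ebasis mxE.
move=> l; rewrite leq_eqVlt => /orP[/eqP dl|dl].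
  have -> : l = i by exact: val_inj.
  have [_ _ sh _] := hA.
  rewrite /= gi sh hj /k /reflection lformZr lform_ebasis mxE eqxx mul1r.
  by rewrite -srightB mulrBl mul1r subKr hconj_mul// sright1.
rewrite /= ge// hl//; apply: reflection_fix; rewrite lform_ebasis mxE.
by case: eqP dl => // <-; rewrite ltnn.
Qed.

End FrameStabilizer.

(** * Covering the quaternions by Hurwitz integers *)

Section Covering.
Variable R : realType.
Local Notation H := (quat R).
Local Notation Hz := (hurwitz R).

Lemma int_round (x : R) : exists m : int, `|x - m%:~R| <= 1 / 2.
Proof.
exists (Num.floor (x + 1 / 2)).
have := floor_le (x + 1 / 2).
have := floorD1_gt (x + 1 / 2); rewrite intrD ler_norml => a b.
by apply/andP; split; lra.
Qed.

(** A real number lies between an integer and a neighbouring half-integer, which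
    are 1/2 apart. *)
Lemma int_halfint_dist (x : R) : exists m k : int,
  `|x - m%:~R| + `|x - (k%:~R + 1 / 2)| = 1 / 2.
Proof.
have := floorD1_gt x; have := floor_le x; set k := Num.floor x.
rewrite intrD => kx xk.
have [y12|y12] := lerP (x - k%:~R) (1 / 2).
  exists k, k; rewrite ger0_norm; last lra.
  by rewrite ler0_norm; lra.
exists (k + 1), k; rewrite intrD ler0_norm; last lra.
by rewrite ger0_norm; lra.
Qed.

Definition qsup_le (u : H) (e : R) :=
  [/\ `|qre u| <= e, `|qci u| <= e, `|qcj u| <= e & `|qck u| <= e].
Definition qsum (u : H) : R := `|qre u| + `|qci u| + `|qcj u| + `|qck u|.

(** Round all coordinates to integers, or all to half-integers.  By
    [int_halfint_dist] the two sums of distances add up to 2, so one of them is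
    at most 1. *)
Lemma hurwitz_covering (q : H) : exists h : Hz,
  qsup_le (q - hval h) (1 / 2) /\ qsum (q - hval h) <= 1.
Proof.
have [m0 [k0 e0]] := int_halfint_dist (qre q).
have [m1 [k1 e1]] := int_halfint_dist (qci q).
have [m2 [k2 e2]] := int_halfint_dist (qcj q).
have [m3 [k3 e3]] := int_halfint_dist (qck q).
have n0 x : 0 <= `|x : R| by exact: normr_ge0.
have := n0 (qre q - m0%:~R); have := n0 (qci q - m1%:~R).
have := n0 (qcj q - m2%:~R); have := n0 (qck q - m3%:~R).
have := n0 (qre q - (k0%:~R + 1 / 2)); have := n0 (qci q - (k1%:~R + 1 / 2)).
have := n0 (qcj q - (k2%:~R + 1 / 2)); have := n0 (qck q - (k3%:~R + 1 / 2)).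
move=> f3 f2 f1 f0 g3 g2 g1 g0.
have [le1|gt1] := lerP (`|qre q - m0%:~R| + `|qci q - m1%:~R| +
                  `|qcj q - m2%:~R| + `|qck q - m3%:~R|) 1.
  exists (hcoordz R (m0 + m0) (m1 - m0) (m2 - m0) (m3 - m0)).
  have -> : q - hval (hcoordz R (m0 + m0) (m1 - m0) (m2 - m0) (m3 - m0)) =
      Quat (qre q - m0%:~R) (qci q - m1%:~R) (qcj q - m2%:~R) (qck q - m3%:~R).
    by apply: quatP; rewrite /= ?(intrD, intrB); field.
  by split=> //; split=> /=; lra.
exists (hcoordz R (k0 + k0 + 1) (k1 - k0) (k2 - k0) (k3 - k0)).
have -> : q - hval (hcoordz R (k0 + k0 + 1) (k1 - k0) (k2 - k0) (k3 - k0)) =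
    Quat (qre q - (k0%:~R + 1 / 2)) (qci q - (k1%:~R + 1 / 2))
         (qcj q - (k2%:~R + 1 / 2)) (qck q - (k3%:~R + 1 / 2)).
  by apply: quatP; rewrite /= ?(intrD, intrB); field.
by split; [split=> /=|rewrite /qsum /=]; lra.
Qed.

Lemma norm_defect (x : R) : `|x| <= 1 / 2 -> x ^+ 2 <= `|x| / 2.
Proof.
move=> xh; rewrite -real_normK ?num_real// expr2.
by have := normr_ge0 x; nra.
Qed.

(** Each coordinate satisfies [x^2 <= |x|/2]. *)
Lemma covering_norm (u : H) : qsup_le u (1 / 2) -> qsum u <= 1 -> qnorm u <= 1 / 2.
Proof.
case=> /norm_defect a /norm_defect b /norm_defect c /norm_defect d.
by rewrite /qsum /qnorm; lra.
Qed.

Lemma norm_defect_eq (x : R) : `|x| <= 1 / 2 -> x ^+ 2 = `|x| / 2 ->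
  [\/ x = 0, x = 1 / 2 | x = - (1 / 2)].
Proof.
have [x0|x0] := lerP 0 x.
  rewrite ger0_norm// expr2 => _ e; have : x * (x - 1 / 2) == 0 by apply/eqP; lra.
  by rewrite mulf_eq0 => /orP[] /eqP; [constructor 1|constructor 2]; lra.
rewrite ltr0_norm// expr2 => _ e; have : x * (x + 1 / 2) == 0 by apply/eqP; lra.
by rewrite mulf_eq0 => /orP[] /eqP; [constructor 1|constructor 3]; lra.
Qed.

(** At norm exactly 1/2 the inequality [x^2 <= |x|/2] is an equality in every
    coordinate, so some coordinate is 1/2 up to sign, and moving by the
    corresponding unit among [+-1, +-i, +-j, +-k] leaves the norm unchanged. *)
Lemma deep_hole (u : H) : qsup_le u (1 / 2) -> qsum u <= 1 -> qnorm u = 1 / 2 ->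
  exists2 e : Hz, e \is a GRing.unit & qnorm (u - hval e) = 1 / 2.
Proof.
case=> a b c d.
have := norm_defect a; have := norm_defect b; have := norm_defect c.
have := norm_defect d => a2 b2 c2 d2; rewrite /qsum => s.
rewrite {1}/qnorm => n1.
have ea : qre u ^+ 2 = `|qre u| / 2 by lra.
have eb : qci u ^+ 2 = `|qci u| / 2 by lra.
have ec : qcj u ^+ 2 = `|qcj u| / 2 by lra.
have ed : qck u ^+ 2 = `|qck u| / 2 by lra.
have E (a' b' c' d' : int) : qnorm (hcoord R a' b' c' d') = 1 ->
    qnorm (u - hcoord R a' b' c' d') = 1 / 2 ->
    exists2 e : Hz, e \is a GRing.unit & qnorm (u - hval e) = 1 / 2.
  by move=> e1 e2; exists (hcoordz R a' b' c' d') => //; rewrite hunitE /= e1.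
have [xa|xa|xa] := norm_defect_eq a ea; last first.
- by apply: (E (-2) 1 1 1); rewrite /qnorm /=; lra.
- by apply: (E 2 (-1) (-1) (-1)); rewrite /qnorm /=; lra.
have [xb|xb|xb] := norm_defect_eq b eb; last first.
- by apply: (E 0 (-1) 0 0); rewrite /qnorm /=; lra.
- by apply: (E 0 1 0 0); rewrite /qnorm /=; lra.
have [xc|xc|xc] := norm_defect_eq c ec; last first.
- by apply: (E 0 0 (-1) 0); rewrite /qnorm /=; lra.
- by apply: (E 0 0 1 0); rewrite /qnorm /=; lra.
have [xd|xd|xd] := norm_defect_eq d ed; last first.
- by apply: (E 0 0 0 (-1)); rewrite /qnorm /=; lra.
- by apply: (E 0 0 0 1); rewrite /qnorm /=; lra.
by move: n1; rewrite xa xb xc xd; lra.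
Qed.
End Covering.

(** * The contraction estimate *)

Section Contraction.
Variable R : realType.
Local Notation H := (quat R).
Local Notation Hz := (hurwitz R).

Definition qinv (q : H) : H := (qnorm q)^-1 *: qconj q.

Lemma qnorm_gt0 (q : H) : q != 0 -> 0 < qnorm q.
Proof.
move=> q0; rewrite lt_def qnorm_ge0 andbT; apply: contra_neq q0.
exact: qnorm_eq0.
Qed.

Lemma qinv_mul (q : H) : q != 0 -> qinv q * q = 1.
Proof.
move=> /qnorm_gt0 q0; have q0' : qnorm q != 0 by rewrite gt_eqF.
have -> : qinv q * q = (qnorm q)^-1 *: (qconj q * q).
  by apply: quatP; rewrite /=; ring.
by rewrite qconj_mul scalerA mulVf// scale1r.
Qed.

Lemma mul_qinv (q : H) : q != 0 -> q * qinv q = 1.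
Proof.
move=> /qnorm_gt0 q0; have q0' : qnorm q != 0 by rewrite gt_eqF.
have -> : q * qinv q = (qnorm q)^-1 *: (q * qconj q).
  by apply: quatP; rewrite /=; ring.
by rewrite qmul_conj scalerA mulVf// scale1r.
Qed.

Lemma qnormZ (x : R) (q : H) : qnorm (x *: q) = x ^+ 2 * qnorm q.
Proof. rewrite /qnorm /=; ring. Qed.

Lemma qnorm_qinv (q : H) : qnorm (qinv q) = (qnorm q)^-1.
Proof.
rewrite qnormZ qnorm_conj.
have [->|q0] := eqVneq (qnorm q) 0; first by rewrite mulr0 invr0.
by rewrite expr2 -mulrA mulVf// mulr1.
Qed.

(** For a unit [a] one has [|1 - a t|^2 = 1 - 2 Re(a t) + |t|^2].  With the
    imaginary signs of [a] opposite to those of [t] this equals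
    [1 - (1 - Re t) Re t - sum (|t_k| - |t_k|^2)] over the imaginary
    coordinates, where each subtracted term is nonnegative and vanishes only
    when the coordinate does. *)
Lemma half_unit_contract (t : H) (d : R) : 0 <= d <= 1 -> qre t = (1 - d) / 2 ->
  `|qci t| <= 1 / 2 -> `|qcj t| <= 1 / 2 -> `|qck t| <= 1 / 2 ->
  (exists2 a : Hz, half_unit a & qnorm (1 - hval a * t) < 1) \/ t = 0 /\ d = 1.
Proof.
move=> /andP[d0 d1] tr ti tj tk.
pose e (x : R) := 0 <= x.
pose a := hcoordz R 1 (- (e (qci t))%:R) (- (e (qcj t))%:R) (- (e (qck t))%:R).
have E (x : R) : ((1%:~R / 2 + (- (e x)%:R : int)%:~R) * x : R) = - (`|x| / 2).
  by rewrite /e; case: ger0P => _ /=; field.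
have na : qnorm (1 - hval a * t) =
  1 - (1 - qre t) * qre t - (`|qci t| - `|qci t| ^+ 2) -
  (`|qcj t| - `|qcj t| ^+ 2) - (`|qck t| - `|qck t| ^+ 2).
  have n1 : qnorm (hval a) = 1 by apply/eqP; apply: half_unit_unit; exact: half_unit_signs.
  have -> : qnorm (1 - hval a * t) = 1 - 2 * qre (hval a * t) + qnorm (hval a) * qnorm t.
    by rewrite -qnormM /qnorm /=; ring.
  have -> : qre (hval a * t) = qre t / 2 + `|qci t| / 2 + `|qcj t| / 2 + `|qck t| / 2.
    by rewrite /= !E !opprK; field.
  by rewrite n1 /qnorm !real_normK ?num_real//; field.
have F (x : R) : `|x| <= 1 / 2 -> 0 <= `|x| - `|x| ^+ 2.
  by move=> x1; have := normr_ge0 x; nra.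
have := F _ ti; have := F _ tj; have := F _ tk => fk fj fi.
have fr : 0 <= (1 - qre t) * qre t by rewrite tr; nra.
have [lt1|ge1] := ltP (qnorm (1 - hval a * t)) 1.
  by left; exists a => //; exact: half_unit_signs.
right; rewrite na in ge1.
have Z (x : R) : `|x| <= 1 / 2 -> `|x| - `|x| ^+ 2 = 0 -> x = 0.
  move=> x1 x2; apply/eqP; rewrite -normr_eq0; apply/eqP.
  by have := normr_ge0 x; nra.
have r0 : (1 - qre t) * qre t = 0 by lra.
have re0 : qre t = 0 by move: r0; rewrite tr => r0; nra.
split; last by lra.
by apply: quatP => //=; apply: Z => //; lra.
Qed.

End Contraction.

(** * Height reduction of null vectors *)

Section HeightReduction.
Variables (R : realType) (n : nat).
Local Notation H := (quat R).
Local Notation Hz := (hurwitz R).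
Local Notation L := (hlat Hz n).
Local Notation rho := (@rho R n).
Implicit Types (v w r l : L) (a b p q : Hz) (i j : 'I_n).

(** The coordinates of [lambda/mu - x]: their norms add up to the squared
    distance from [lambda/mu] to the lattice point [x]. *)
Definition offset v (x : 'cV[Hz]_n) i : H :=
  hval (v.1 i 0) * qinv (hval v.2.1) - hval (x i 0).

(** The real part of the equation saying that [v] is null. *)
Lemma null_re v : null v ->
  \sum_i qnorm (hval (v.1 i 0)) = - (2 * qre (qconj (hval v.2.1) * hval v.2.2)).
Proof.
move=> /(congr1 (fun t => qre (hval t))); rewrite lformE /= => e.
apply/eqP; rewrite -subr_eq0 opprK; apply/eqP; rewrite -[RHS]e.
rewrite hval_sum qre_sum; congr (_ + _); last by ring.
by apply: eq_bigr => i _; rewrite /qnorm /=; ring.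
Qed.

Lemma sum_norm_int (x : 'cV[Hz]_n) : exists N : int,
  \sum_i qnorm (hval (x i 0)) = N%:~R.
Proof.
apply: (big_ind (fun y : R => exists N : int, y = N%:~R)).
- by exists 0.
- by move=> _ _ [N ->] [M ->]; exists (N + M); rewrite intrD.
- by move=> i _; exact: hurwitz_norm_int.
Qed.

(** The root has the prescribed [Lambda] component [x], height 1, and last
    coordinate chosen so that [half_unit_contract] applies to [<r|v>/mu]. *)
Lemma height_step v (x : 'cV[Hz]_n) : null v -> v.2.1 != 0 ->
  \sum_i qnorm (offset v x i) <= 1 ->
  (exists2 s : L -> L, Reflec0 s & qnorm (hval (s v).2.1) < qnorm (hval v.2.1)) \/
  (\sum_i qnorm (offset v x i) = 1 /\ exists k, lform (x, (1, k)) v = 0).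
Proof.
move=> v0 m0; set d := \sum_i _ => d1.
have m0' : hval v.2.1 != 0.
  by apply: contra_neq m0 => e; apply: val_inj.
set m := hval v.2.1 in m0'; pose nu := hval v.2.2; pose w i := hval (v.1 i 0) * qinv m.
have M0 : qnorm m != 0 by rewrite gt_eqF// qnorm_gt0.
have [N eN] := sum_norm_int x.
pose c := \sum_i qconj (hval (x i 0)) * w i + nu * qinv m.
have ew : \sum_i qnorm (w i) = - (2 * qre (nu * qinv m)).
  have -> : qre (nu * qinv m) = (qnorm m)^-1 * qre (qconj m * nu).
    by rewrite /qinv /=; ring.
  rewrite mulrCA -mulrN -null_re// mulr_sumr; apply: eq_bigr => i _.
  by rewrite /w qnormM qnorm_qinv mulrC.
have rec : qre c = (N%:~R - d) / 2.
  have -> : d = \sum_i (qnorm (w i) + qnorm (hval (x i 0)) -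
                        2 * qre (qconj (hval (x i 0)) * w i)).
    apply: eq_bigr => i _; rewrite /offset -/m -/(w i).
    by move: (w i) => y; rewrite /qnorm /=; ring.
  rewrite sumrB -mulr_sumr -qre_sum /c qreD.
  rewrite (_ : \sum_i _ = - (2 * qre (nu * qinv m)) + N%:~R).
    by move: (qre _) (qre _) => y z; field.
  by rewrite big_split /= ew eN.
have [b1 e1] := int_round (qci c - (1 - N%:~R) / 2).
have [b2 e2] := int_round (qcj c - (1 - N%:~R) / 2).
have [b3 e3] := int_round (qck c - (1 - N%:~R) / 2).
(* The real part [(1 - N)/2] gives the root norm 1; the other coordinates are
   [(1 - N)/2] plus free integers. *)
pose k := hcoordz R (1 - N) b1 b2 b3.
pose t := c + qconj (hval k).
pose r : L := (x, (1, k)).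
have r1 : lform r r = 1.
  apply: val_inj; rewrite lformE /= hval_sum.
  have -> : \sum_i hval (hconj (x i 0) * x i 0) = N%:~R *: (1 : H).
    by rewrite -eN scaler_suml; apply: eq_bigr => i _; rewrite /= qconj_mul.
  by apply: quatP; rewrite /= ?intrB; field.
have et : hval (lform r v) = t * m.
  rewrite lformE /= hval_sum /t /c !mulrDl -mulrA qinv_mul// mulr1.
  have -> : qconj 1 = 1 :> H by apply: quatP => /=; ring.
  rewrite mul1r addrA; congr (_ + _ + _).
  rewrite mulr_suml; apply: eq_bigr => i _.
  by rewrite /w -!mulrA qinv_mul// mulr1.
have d0 : 0 <= d by apply: sumr_ge0 => i _; exact: qnorm_ge0.
have := @half_unit_contract R t d; case.
- by rewrite d0.
- by rewrite qreD rec /= intrB; field.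
- by move: e1; congr (`|_| <= _); rewrite /= intrB; ring.
- by move: e2; congr (`|_| <= _); rewrite /= intrB; ring.
- by move: e3; congr (`|_| <= _); rewrite /= intrB; ring.
- move=> [a ha at1]; left; exists (reflection (1 - a) r).
    by apply: Reflec0_reflection => //; exact: half_unit_compl.
  have -> : hval (reflection (1 - a) r v).2.1 = (1 - hval a * t) * m.
    have -> : (reflection (1 - a) r v).2.1 = v.2.1 - 1 * (a * lform r v).
      by rewrite /reflection subKr.
    have -> : hval (v.2.1 - 1 * (a * lform r v)) = m - hval a * hval (lform r v).
      by rewrite mul1r.
    by rewrite et mulrBl mul1r mulrA.
  by rewrite qnormM gtr_pMl// qnorm_gt0.
- move=> [t0 dd]; right; split=> //; exists k.
  by apply: val_inj; move: et; rewrite t0 mul0r.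
Qed.

(** When the nearest lattice point [x] fails, all coordinates of the offset have
    norm 1/2, so [deep_hole] provides another nearest point [y].  If that fails
    too, [v] is orthogonal to two short roots whose difference is
    [(e_i e;0,p)]. *)
Lemma height_reduction v : (n <= 2)%N -> null v -> v.2.1 != 0 ->
  exists2 s : L -> L, Reflec0 s & qnorm (hval (s v).2.1) < qnorm (hval v.2.1).
Proof.
move=> n2 v0 m0.
have m0' : hval v.2.1 != 0 by apply: contra_neq m0 => e; apply: val_inj.
have [f ff] := choice (fun i => hurwitz_covering (hval (v.1 i 0) * qinv (hval v.2.1))).
pose x : 'cV[Hz]_n := \col_i f i.
have hx i : qsup_le (offset v x i) (1 / 2) /\ qsum (offset v x i) <= 1.
  by rewrite /offset mxE.
have nx i : qnorm (offset v x i) <= 1 / 2 by have [] := hx i; exact: covering_norm.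
have : \sum_(i < n) qnorm (offset v x i) <= \sum_(i < n) (1 / 2 : R).
  by apply: ler_sum.
rewrite sumr_const card_ord => sx.
have nR : n%:R <= 2 :> R by rewrite (ler_nat _ _ 2).
have sx1 : \sum_i qnorm (offset v x i) <= 1.
  by apply: le_trans sx _; rewrite -mulr_natr; lra.
have [//|[d1 [k ek]]] := height_step v0 m0 sx1.
have [i ni] : exists i, qnorm (offset v x i) = 1 / 2.
  have n0 : (0 < n)%N.
    rewrite lt0n; apply: contra_eqN d1 => /eqP n0.
    rewrite big1 => [|i _]; first by rewrite eq_sym oner_eq0.
    by exfalso; move: (ltn_ord i); move: (nat_of_ord i) => q; rewrite n0.
  exists (Ordinal n0); apply/eqP; rewrite eq_sym -subr_eq0; apply/eqP.
  have := @psumr_eq0P R _ xpredT (fun i => 1 / 2 - qnorm (offset v x i)); apply=> //.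
    by move=> i _; rewrite subr_ge0.
  apply/eqP; rewrite eq_le sumr_ge0 ?andbT => [|i _]; last by rewrite subr_ge0.
  by rewrite sumrB d1 sumr_const card_ord -mulr_natr; lra.
have [hi hi'] := hx i.
have [e eU ne] := deep_hole hi hi' ni.
pose y : 'cV[Hz]_n := x + evec i e.
have yi j : offset v y j = if j == i then offset v x j - hval e else offset v x j.
  rewrite /offset !mxE; case: eqP => _; rewrite /= ?addr0// opprD addrA//.
have dy : \sum_j qnorm (offset v y j) = 1.
  rewrite -d1 [LHS](bigD1 i)//= [RHS](bigD1 i)//= yi eqxx ne ni; congr (_ + _).
  by apply: eq_bigr => j /negPf ji; rewrite yi ji.
have dy1 : \sum_j qnorm (offset v y j) <= 1 by rewrite dy.
have [//|[_ [k' ek']]] := height_step v0 m0 dy1.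
(* Orthogonality to the difference of the roots makes [lambda_i/mu] a Hurwitz
   integer, which contradicts the offset of norm 1/2. *)
have e0 : v.1 i 0 = e * hconj (k - k') * v.2.1.
  have : lform (evec i e, (0, k' - k)) v = 0.
    have -> : (evec i e, (0, k' - k)) = (y, (1, k')) - (x, (1, k)) :> L.
      by congr (_, (_, _)); rewrite /= ?subrr// /y addrAC subrr add0r.
    by rewrite lformBl ek ek' subrr.
  rewrite /lform /hform /hyp /= dot_evec hconj0 mul0r add0r => /eqP.
  rewrite addr_eq0 => /eqP /(congr1 ( *%R e)).
  rewrite mulrA hmul_conj// mul1r => ->.
  by rewrite -mulNr -hconjN opprB mulrA.
have oi : offset v x i = hval (e * hconj (k - k') - x i 0).
  by rewrite /offset e0 /= -!mulrA mul_qinv// mulr1.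
have [N eN] := hurwitz_norm_int (e * hconj (k - k') - x i 0).
have : (2 * N)%:~R = 1%:~R :> R.
  by rewrite intrM -eN -oi ni; field.
by move/eqP; rewrite eqr_int => /eqP /(congr1 absz) /(congr1 odd); rewrite abszM oddM.
Qed.

End HeightReduction.

(** * Unit multiples of a null vector *)

Section UnitMultiples.
Variables (R : realType) (n : nat).
Local Notation H := (quat R).
Local Notation Hz := (hurwitz R).
Local Notation L := (hlat Hz n).
Local Notation rho := (@rho R n).
Implicit Types (v w r l : L) (a b p q u : Hz) (i j : 'I_n).

(** The units [u] such that [rho u] lies in the orbit of [rho]; by right
    linearity they are closed under products. *)
Definition reached u := exists2 s : L -> L, Reflec0 s & s rho = sright rho u.

Lemma reached1 : reached 1.
Proof. by exists id; [exact: Reflec0_id|rewrite sright1]. Qed.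

Lemma reachedM a b : reached a -> reached b -> reached (a * b).
Proof.
move=> [s sR es] [t tR et]; exists (s \o t); first exact: Reflec0_comp.
by have [_ _ ss _] := Reflec0_AutL sR; rewrite /= et ss es sright_mul.
Qed.

(** The first reflection sends [rho] to [- sigma a], the second one returns it to
    the line of [rho]. *)
Lemma reached_half_units a b : half_unit a -> half_unit b -> reached (b * a).
Proof.
move=> ha hb.
exists (reflection (1 - b) (0, (1, b)) \o reflection (1 - a) (0, (1, hconj a))).
  by apply: Reflec0_comp; [exact: Reflec0_half_hyp|exact: Reflec0_half_hyp_conj].
rewrite /= half_unit_reflection_col// half_unit_reflection_row//.
rewrite scol0 !(mulr0, mulr1) !(add0r, addr0, subr0, oppr0).
by rewrite !mulr0 mulrN opprK !oppr0 add0r mul0r mul1r.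
Qed.

Lemma half_unitP u : u \is a GRing.unit -> qre (hval u) = 1 / 2 -> half_unit u.
Proof.
move=> uU re; split; first exact: hconj_mul.
by apply: val_inj; apply: quatP; rewrite /= ?re; field.
Qed.

Lemma reached_neg1 : reached (- 1).
Proof.
pose a := hcoordz R 1 0 0 0; pose b := hcoordz R 1 0 0 (-1).
have ha : half_unit a by exact: (half_unit_signs R false false false).
have hb : half_unit b by exact: (half_unit_signs R false false true).
(* The product [a b] is [j]. *)
have -> : - 1 = (a * b) * (a * b) by hurwitz_field.
by apply: reachedM; exact: reached_half_units.
Qed.

Lemma reached_opp u : reached u -> reached (- u).
Proof. by rewrite -mulN1r; apply: reachedM; exact: reached_neg1. Qed.

Lemma reached_half u : half_unit u -> reached u.
Proof.
move=> hu; rewrite -[u]opprK; apply: reached_opp.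
(* Since [u] has order 6, [u^3 = -1]. *)
have -> : - u = (u * u) * (u * u).
  rewrite (half_unit_sqr hu) mulrBr mulr1 mulrBl mul1r (half_unit_sqr hu).
  by hurwitz_ring.
by apply: reachedM; exact: reached_half_units.
Qed.

(** Twice the real part of a Hurwitz unit is an integer between -2 and 2.  The
    extreme cases are [1] and [-1], real part [+- 1/2] is covered by units of order
    6, and a purely imaginary unit is the product of a unit of real part
    [+- 1/2] and [(1 + i + j + k)/2]. *)
Lemma reached_unit u : u \is a GRing.unit -> reached u.
Proof.
have re1 (q : H) : qnorm q = 1 -> qre q ^+ 2 = 1 -> q = Quat (qre q) 0 0 0.
  rewrite {1}/qnorm => q1 r1; have := sqr_ge0 (qci q); have := sqr_ge0 (qcj q).
  have := sqr_ge0 (qck q) => k0 j0 i0.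
  by apply: quatP => //=; apply/eqP; rewrite -sqrf_eq0; apply/eqP; lra.
have half (w : Hz) : w \is a GRing.unit ->
    qre (hval w) = 1 / 2 \/ qre (hval w) = - (1 / 2) -> reached w.
  move=> wU [re|re]; first by apply: reached_half; exact: half_unitP.
  rewrite -[w]opprK; apply: reached_opp; apply: reached_half; apply: half_unitP.
    by rewrite unitrN.
  by rewrite /= re opprK.
move=> uU; have /hurwitzP[a [b [c [d eu]]]] := valP u.
have := uU; rewrite hunitE => /eqP nu.
have small (x : int) (y : R) : (x%:~R) ^+ 2 + y = 1 -> 0 <= y ->
    [\/ x = 0, x = 1 | x = -1].
  move=> e y0; have : (-2 < x < 2)%R.
    by rewrite -!(ltr_int R); apply/andP; split; nra.
  by case: x {e} => [[|[|?]]|[|?]] // _; [constructor 1|constructor 2|constructor 3].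
have : (-3 < a < 3)%R.
  rewrite -!(ltr_int R); move: nu; rewrite eu /qnorm /= => nu.
  have := sqr_ge0 (a%:~R / 2 + b%:~R : R); have := sqr_ge0 (a%:~R / 2 + c%:~R : R).
  have := sqr_ge0 (a%:~R / 2 + d%:~R : R) => d2 c2 b2.
  by apply/andP; split; nra.
case: a eu => [[|[|[|?]]]|[|[|?]]] // eu _.
- have e : (b%:~R : R) ^+ 2 + (c%:~R ^+ 2 + d%:~R ^+ 2) = 1.
    by move: nu; rewrite eu /qnorm /= => e0; rewrite -[RHS]e0; field.
  have e' : (c%:~R : R) ^+ 2 + (b%:~R ^+ 2 + d%:~R ^+ 2) = 1 by rewrite -[RHS]e; ring.
  have e'' : (d%:~R : R) ^+ 2 + (b%:~R ^+ 2 + c%:~R ^+ 2) = 1 by rewrite -[RHS]e; ring.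
  have hb := small _ _ e (addr_ge0 (sqr_ge0 _) (sqr_ge0 _)).
  have hc := small _ _ e' (addr_ge0 (sqr_ge0 _) (sqr_ge0 _)).
  have hd := small _ _ e'' (addr_ge0 (sqr_ge0 _) (sqr_ge0 _)).
  pose g := hcoordz R 1 0 0 0.
  have hg : half_unit g by exact: (half_unit_signs R false false false).
  have gU := half_unit_unit hg.
  have -> : u = (u * hconj g) * g by rewrite -mulrA hconj_mul// mulr1.
  apply: reachedM; last exact: reached_half.
  apply: half; first by rewrite unitrMr ?unit_hconj.
  (* Exactly one of [b], [c], [d] is nonzero, so [b + c + d] is 1 or -1. *)
  have ez : b * b + (c * c + d * d) == 1.
    by rewrite -(eqr_int R) !(intrD, intrM) -!expr2 e.
  have -> : qre (hval (u * hconj g)) = (b + c + d)%:~R / 2.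
    by rewrite /= eu /= !intrD; field.
  move: ez; case: hb => ->; case: hc => ->; case: hd => -> // _; rewrite /=;
    by [left; field|right; field].
- by apply: half => //; left; rewrite eu.
- have -> : u = 1.
    apply: val_inj; rewrite /= (re1 _ nu) eu /=; last by field.
    by apply: quatP => //=; field.
  exact: reached1.
- by apply: half => //; right; rewrite eu /=; field.
- have -> : u = -1.
    apply: val_inj; rewrite /= (re1 _ nu) eu /=; last by field.
    by apply: quatP => /=; field.
  exact: reached_neg1.
Qed.

End UnitMultiples.

(** * Transitivity and generation of the automorphism group *)

Section Transitivity.
Variables (R : realType) (n : nat).
Local Notation H := (quat R).
Local Notation Hz := (hurwitz R).
Local Notation L := (hlat Hz n).
Local Notation rho := (@rho R n).
Implicit Types (v w r l : L) (a b p q u : Hz) (i j : 'I_n).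

(** At height 0 the equation [v^2 = 0] says that the [Lambda] component has
    norm 0. *)
Lemma height0_reached v : null v -> primitive v -> v.2.1 = 0 ->
  exists2 u, u \is a GRing.unit & v = sright rho u.
Proof.
move=> v0 [_ pv] m0.
have x0 i : v.1 i 0 = 0.
  apply: val_inj; apply: qnorm_eq0; move: (null_re v0); rewrite m0.
  have -> : qconj (hval 0) * hval v.2.2 = 0 :> H by apply: quatP => /=; ring.
  move=> /= e; apply: (psumr_eq0P _ (etrans e _)) => //; last by rewrite mulr0 oppr0.
  by move=> j _; exact: qnorm_ge0.
have e : v = sright rho v.2.2.
  rewrite /= scol0 mul0r mul1r -m0; case: v x0 {v0 pv m0} => x [m k] /= x0.
  by congr (_, _); apply/colP => i; rewrite mxE x0.
by exists v.2.2 => //; exact: pv e.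
Qed.

Lemma AutL_null g v : AutL g -> null v -> null (g v).
Proof. by move=> [_ _ _ lg]; rewrite /null lg. Qed.

Lemma AutL_primitive g v : AutL g -> primitive v -> primitive (g v).
Proof.
move=> gA [v0 pv]; have [g' [g'A gg' g'g]] := AutL_exists_inv gA.
split=> [gv|w a e].
  have g'0 : g' 0 = 0 by have := AutLB 0 0 g'A; rewrite !subrr.
  by apply: v0; rewrite -[v]gg' gv.
have [_ _ sg' _] := g'A.
by apply: (pv (g' w)); rewrite -sg' -e gg'.
Qed.

(** The norm of the height is a natural number, so height reduction terminates. *)
Lemma null_clear_height v : (n <= 2)%N -> null v ->
  exists2 s : L -> L, Reflec0 s & (s v).2.1 = 0.
Proof.
move=> n2; have [m em] := hnorm_nat v.2.1.
elim/ltn_ind: m v em => m IHm v em v0.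
have [e|m0] := eqVneq v.2.1 0; first by exists id => //; exact: Reflec0_id.
have [s sR lt] := height_reduction n2 v0 m0.
have [k ek] := hnorm_nat (s v).2.1.
have [|t tR te] := IHm k _ (s v) ek (AutL_null (Reflec0_AutL sR) v0).
  by move: lt; rewrite ek em ltr_nat.
by exists (t \o s) => //; exact: Reflec0_comp.
Qed.

Lemma null_primitive_to_rho v : (n <= 2)%N -> null v -> primitive v ->
  exists2 s : L -> L, Reflec0 s & s v = rho.
Proof.
move=> n2 v0 pv; have [s sR s0] := null_clear_height n2 v0.
have sA := Reflec0_AutL sR.
have [u uU eu] := height0_reached (AutL_null sA v0) (AutL_primitive sA pv) s0.
have [t tR et] := reached_unit n uU.
have [t' [t'A tt' t't]] := AutL_exists_inv (Reflec0_AutL tR).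
exists (t' \o s); last by rewrite /= eu -et tt'.
by apply: Reflec0_comp => //; exact: Reflec0_inv tR tt' t't.
Qed.

Lemma null_primitive_transitive : (n <= 2)%N ->
  acts_transitively (@Reflec0 R n) [set v | primitive v /\ null v].
Proof.
move=> n2; split=> [g v gR [pv v0]|v w [pv v0] [pw w0]].
  have gA := Reflec0_AutL gR.
  by split; [exact: AutL_primitive|exact: AutL_null].
have [s sR es] := null_primitive_to_rho n2 v0 pv.
have [t tR et] := null_primitive_to_rho n2 w0 pw.
have [t' [t'A tt' t't]] := AutL_exists_inv (Reflec0_AutL tR).
exists (t' \o s); last by rewrite /= es -et tt'.
by apply: Reflec0_comp => //; exact: Reflec0_inv tR tt' t't.
Qed.

Lemma null_rho : null rho.
Proof. by rewrite /null lform_rho. Qed.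

Lemma primitive_rho : primitive rho.
Proof.
split=> [/(congr1 (fun v => v.2.2)) /eqP|[x [m k]] a e].
  by rewrite oner_eq0.
have [p ep] := hnorm_nat k; have [q eq] := hnorm_nat a.
have := congr1 (fun v => qnorm (hval v.2.2)) e; rewrite /= qnormM qnorm1 ep eq.
rewrite -natrM => /eqP; rewrite eq_sym (eqr_nat _ _ 1) muln_eq1 => /andP[_ /eqP q1].
by rewrite hunitE eq q1.
Qed.

Lemma AutL_sub_ctrans_Reflec0 (g : L -> L) : (n <= 2)%N -> AutL g -> ctrans_Reflec0 g.
Proof.
move=> n2 gA.
have [s sR srho] := null_primitive_to_rho n2 (AutL_null gA null_rho)
  (AutL_primitive gA primitive_rho).
have sG := ctrans_Reflec0_Reflec0 sR.
have sgA : AutL (s \o g) by apply: AutL_comp => //; exact: Reflec0_AutL.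
apply: (ctrans_Reflec0_cancel sG).
have [_ _ _ lsg] := sgA.
have h1 : ((s \o g) (sigma R n)).2.1 = 1.
  by rewrite -lform_rho -srho lsg lform_rho.
have eta (w : L) : w.2.1 = 1 -> w = (w.1, (1, w.2.2)) by case: w => x [m k] /= ->.
have [t tR [trho [k ek]]] :=
  Reflec0_clear ((s \o g) (sigma R n)).1 ((s \o g) (sigma R n)).2.2.
have tG := ctrans_Reflec0_Reflec0 tR.
have tsgA : AutL (t \o (s \o g)) by apply: AutL_comp => //; exact: Reflec0_AutL.
have es : (t \o (s \o g)) (sigma R n) = (0, (1, k)).
  by rewrite -ek -(eta _ h1).
apply: (ctrans_Reflec0_cancel tG).
have [_ _ _ l3] := tsgA.
have kk : hconj (- k) = - - k.
  have := l3 (sigma R n) (sigma R n).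
  rewrite es lform_sigma lform_hyp /= hconj1 mul1r mulr1.
  by move=> /eqP; rewrite addr_eq0 hconjN opprK => /eqP/esym.
have kG := ctrans_Reflec0_ctrans n kk.
(* After the last translation both [rho] and [sigma] are fixed. *)
apply: (ctrans_Reflec0_cancel kG); apply: ctrans_Reflec0_frame.
- by apply: AutL_comp => //; exact: AutL_ctrans.
- by rewrite /= srho trho /ctrans /= mulr0 addr0.
- by rewrite [LHS]/= -/((t \o (s \o g)) _) es /ctrans /= mulr1 subrr.
Qed.

End Transitivity.

(** * Coset representatives *)

Section Cosets.
Variables (R : realType) (n : nat).
Local Notation H := (quat R).
Local Notation Hz := (hurwitz R).
Local Notation L := (hlat Hz n).
Local Notation S := (@Reflec0 R n).

Definition rep_ctrans (k : nat) : L -> L := ctrans (nth 0 (icoset_reps R) k).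

Lemma icoset_reps_imaginary (y : Hz) : y \in icoset_reps R -> hconj y = - y.
Proof. by rewrite !inE => /or4P[] /eqP ->; hurwitz_field. Qed.

Lemma icoset_reps_hval (y : Hz) : y \in icoset_reps R ->
  hval y \in [:: 0; qi; qj; qk].
Proof.
have e1 : hval (hcoordz R 0 1 0 0) = qi by apply: quatP => /=; field.
have e2 : hval (hcoordz R 0 0 1 0) = qj by apply: quatP => /=; field.
have e3 : hval (hcoordz R 0 0 0 1) = qk by apply: quatP => /=; field.
by rewrite !inE => /or4P[] /eqP ->; rewrite ?e1 ?e2 ?e3 eqxx ?orbT.
Qed.

Lemma rep_ctrans_AutL k : (k < 4)%N -> AutL (rep_ctrans k).
Proof.
by move=> k4; apply/AutL_ctrans/icoset_reps_imaginary/mem_nth.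
Qed.

Lemma ctrans_translation (z : Hz) :
  restricts_to (@ctrans R n z) (translation 0 (hval z)).
Proof.
have d0 (x : 'cV[H]_n) : dot (@qconj R) 0 x = 0.
  rewrite /dot big1// => i _; rewrite mxE.
  by apply: quatP => /=; ring.
move=> [x [m k]]; rewrite /toLR /ctrans /= !d0 scaler0 !subr0.
congr (_, _); apply/colP => i; rewrite !mxE mul0r addr0//.
Qed.

Lemma rep_ctrans_central k : (k < 4)%N -> central_translations (rep_ctrans k).
Proof.
move=> k4; exists (hval (nth 0 (icoset_reps R) k)); last exact: ctrans_translation.
by apply/icoset_reps_hval/mem_nth.
Qed.

Lemma AutL_rep_coset (g : L -> L) : (0 < n <= 2)%N -> AutL g ->
  exists2 k, (k < 4)%N & left_coset (rep_ctrans k) S g.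
Proof.
move=> /andP[n0 n2] /(AutL_sub_ctrans_Reflec0 n2)[z [s [zi sR ->]]].
have [y yr yR] := ctrans_coset_rep (Ordinal n0) zi.
exists (index y (icoset_reps R)); first by rewrite -index_mem in yr.
exists (ctrans (z - y) \o s); first exact: Reflec0_comp.
by rewrite /rep_ctrans nth_index//; apply/funext => v; rewrite /= ctransD addrC subrK.
Qed.

Lemma left_coset_refl (g : L -> L) : left_coset g S g.
Proof. by exists id => //; exact: Reflec0_id. Qed.

Lemma left_coset_eq (f g : L -> L) : left_coset f S g -> left_coset g S = left_coset f S.
Proof.
move=> [s sR <-]; have [s' [s'A ss' s's]] := AutL_exists_inv (Reflec0_AutL sR).
apply/seteqP; split=> _ [t tR <-].
  by exists (s \o t) => //; exact: Reflec0_comp.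
exists (s' \o t); first by apply: Reflec0_comp => //; exact: Reflec0_inv sR ss' s's.
by apply/funext => v /=; rewrite s's.
Qed.

Lemma left_cosets_card : (0 < n <= 2)%N -> left_cosets (@AutL R n) S #<= `I_4.
Proof.
move=> n02.
apply: card_le_trans (card_image_le (fun k => left_coset (rep_ctrans k) S) `I_4).
apply: subset_card_le => _ [g gA <-].
have [k k4 kg] := AutL_rep_coset n02 gA.
by exists k => //; rewrite (left_coset_eq kg).
Qed.

(** Some of the four translations may lie in the same coset; keeping the one of
    least index makes the representatives unique. *)
Definition least_reps : set (L -> L) := [set c | exists k,
  [/\ (k < 4)%N, c = rep_ctrans k &
      forall j, (j < k)%N -> ~ left_coset (rep_ctrans j) S c]].

Lemma least_reps_coset_reps : (0 < n <= 2)%N -> coset_reps (@AutL R n) S least_reps.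
Proof.
move=> n02; split=> [_ [k [k4 -> _]]|g gA]; first exact: rep_ctrans_AutL.
have ex : exists k, `[< (k < 4)%N /\ left_coset (rep_ctrans k) S g >].
  by have [k k4 kg] := AutL_rep_coset n02 gA; exists k; apply/asboolP.
case: (ex_minnP ex) => k /asboolP[k4 kg] kmin.
exists (rep_ctrans k); split.
  split=> //; exists k; split=> // j jk jc.
  have : (k <= j)%N.
    apply: kmin; apply/asboolP; split; first exact: ltn_trans k4.
    by rewrite -(left_coset_eq jc).
  by rewrite leqNgt jk.
move=> _ [[k' [k'4 -> k'min]] k'g].
have kk' : (k <= k')%N by apply: kmin; apply/asboolP.
move: kk'; rewrite leq_eqVlt => /orP[/eqP -> //|lt].
case: (k'min _ lt); rewrite -(left_coset_eq kg) (left_coset_eq k'g).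
exact: left_coset_refl.
Qed.

End Cosets.

Theorem theorem6p8 (R : realType) (n : nat) (hn : n = 1%N \/ n = 2%N) :
  [/\ acts_transitively (@Reflec0 R n)
        [set v | primitive v /\ null v],
      left_cosets (@AutL R n) (@Reflec0 R n) #<= `I_4 &
      exists2 C, C `<=` @central_translations R n &
                 coset_reps (@AutL R n) (@Reflec0 R n) C].
Proof.
have n02 : (0 < n <= 2)%N by case: hn => ->.
split; first by apply: null_primitive_transitive; case/andP: n02.
  exact: left_cosets_card.
exists (@least_reps R n); last exact: least_reps_coset_reps.
by move=> _ [k [k4 -> _]]; exact: rep_ctrans_central.
Qed.
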